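(* Fix a nonempty finite set $\Lambda\subseteq\mathbb{Z}^d$, an integer $N\ge2$ and $\beta\in\mathbb{R}$, and let $\langle\cdot\rangle$ denote expectation in $SO(N)$ lattice gauge theory on $\Lambda$ at inverse coupling $\beta$. For a non-null loop sequence $s$ with minimal representation $(l_1,\dots,l_n)$ whose loops lie in $\Lambda$, define $\phi(s)=\langle W_{l_1}\cdots W_{l_n}\rangle/N^n$. If every vertex of $\mathbb{Z}^d$ at distance at most $1$ from a vertex of some $l_i$ belongs to $\Lambda$, then $$(N-1)|s|\phi(s)=\sum_{s'\in\mathbb{T}^-(s)}\phi(s')-\sum_{s'\in\mathbb{T}^+(s)}\phi(s')+N\sum_{s'\in\mathbb{S}^-(s)}\phi(s')-N\sum_{s'\in\mathbb{S}^+(s)}\phi(s')+\frac1N\sum_{s'\in\mathbb{M}^-(s)}\phi(s')-\frac1N\sum_{s'\in\mathbb{M}^+(s)}\phi(s')+N\beta\sum_{s'\in\mathbb{D}^-(s)}\phi(s')-N\beta\sum_{s'\in\mathbb{D}^+(s)}\phi(s').$$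
   Context: Lattice, paths and loops. $E$ is the set of directed nearest-neighbour edges of $\mathbb{Z}^d$ ($d\ge2$); $e$ goes from $u(e)$ to $v(e)$, $e^{-1}$ is the reversed edge; $e$ is positively oriented if $v(e)$ is lexicographically larger than $u(e)$. A path is a sequence $e_1\cdots e_n$ with $v(e_i)=u(e_{i+1})$, closed if $v(e_n)=u(e_1)$; the null path is closed. Cycles are classes of closed paths under cyclic rotation; each cycle has a first edge fixed by an arbitrary rule, and ''location $k$'' is its $k$-th edge. A path has a backtrack at $i\le n-1$ if $e_{i+1}=e_i^{-1}$; a closed path also at $n$ if $e_1=e_n^{-1}$; erasing a backtrack at $i<n$ gives $e_1\cdots e_{i-1}e_{i+2}\cdots e_n$, at $n$ gives $e_2\cdots e_{n-1}$; successive erasures until none remain give a well-defined cycle $[l]$ (nonbacktracking core). A loop is a cycle without backtracks (including the null loop). A plaquette is a nonbacktracking closed path of length 4; $\mathcal{P}^+$ is the set of plaquettes $e_1e_2e_3e_4$ with $u(e_1)$ lexicographically smallest and $v(e_1)$ second smallest among its vertices. Loop sequences: finite sequences of loops modulo inserting/deleting null loops; minimal representation without null loops; length $|s|=\sum|l_i|$. Operations on loops. For non-null loops $l,l'$ and locations $x$ in $l$, $y$ in $l'$: if both carry edge $e$, write $l=aeb$, $l'=ced$, positive merger $l\oplus_{x,y}l'=[aedceb]$, negative merger $l\ominus_{x,y}l'=[ac^{-1}d^{-1}b]$; if $l$ has $e$ at $x$ and $l'$ has $e^{-1}$ at $y$, write $l=aeb$, $l'=ce^{-1}d$, $l\oplus_{x,y}l'=[aec^{-1}d^{-1}eb]$,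 $l\ominus_{x,y}l'=[adcb]$. Positive/negative deformations of $l$: $l\oplus_{x,y}p$, $l\ominus_{x,y}p$ with $p$ a plaquette containing the edge at location $x$ of $l$ or its inverse (at its unique location $y$ in $p$). For distinct locations $x,y$ of $l$: if $l$ has $e$ at both, write $l=aebec$ (displayed $e$'s at $x$, $y$ respectively), positive splitting $\times^1_{x,y}l=[aec]$, $\times^2_{x,y}l=[be]$, negative twisting $\propto_{x,y}l=[ab^{-1}c]$; if $l$ has $e$ at $x$, $e^{-1}$ at $y$, write $l=aebe^{-1}c$, negative splitting $\times^1_{x,y}l=[ac]$, $\times^2_{x,y}l=[b]$, positive twisting $\propto_{x,y}l=[aeb^{-1}e^{-1}c]$. Operations on loop sequences. For $s$ with minimal representation $(l_1,\dots,l_n)$: a deformation/twisting of $s$ replaces one $l_k$ by a deformation/twisting of it; a splitting replaces $l_k$ by $\times^1_{x,y}l_k,\times^2_{x,y}l_k$; a merger replaces $l_k$ by $l_k\oplus_{x,y}l_r$ (or $\ominus$) for some $r\ne k$ and deletes $l_r$. $\mathbb{D}^\pm(s),\mathbb{S}^\pm(s),\mathbb{M}^\pm(s),\mathbb{T}^\pm(s)$ are the collections of positive/negative deformations, splittings, mergers, twistings of $s$, counted with multiplicity: one element for each choice of component(s), ordered pair of locations and plaquette; in particular operations at $(x,y)$ and $(y,x)$ are distinct elements, as are merging $l_k$ with $l_r$ at $(x,y)$ and $l_r$ with $l_k$ at $(y,x)$. Sums are taken with multiplicity. Gauge theory. $\sigma_N$ is Haar probability on $SO(N)$; $E^+_\Lambda$,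 $\mathcal{P}^+_\Lambda$ are the positively oriented edges, resp. elements of $\mathcal{P}^+$, with all vertices in $\Lambda$; the measure has density $Z^{-1}\exp(N\beta\sum_{p\in\mathcal{P}^+_\Lambda}\mathrm{Tr}(Q_p))$ w.r.t. $\prod_{e\in E^+_\Lambda}d\sigma_N(Q_e)$, $Q_{e^{-1}}=Q_e^{-1}$, $Q_p=Q_{e_1}\cdots Q_{e_4}$. $W_l=\mathrm{Tr}(Q_{e_1}\cdots Q_{e_n})$ for $l=e_1\cdots e_n$ and $W_\emptyset=N$; $\phi$ is thus well defined on loop sequences (null loops contribute factor $N/N=1$), with $\phi(\emptyset)=1$.
   Formalization: In the deformations, the plaquettes p range only over P^+ (one per unit square), not over all nonbacktracking closed paths of length 4; counting every orientation and starting point would multiply the deformation sums by 8 and make the identity false. *)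

(* Defs.v *)
From HB Require Import structures.
From mathcomp Require Import all_boot all_order all_algebra.
From mathcomp Require Import all_classical all_reals all_analysis.
Set Implicit Arguments. Unset Strict Implicit. Unset Printing Implicit Defensive.
Import Order.TTheory GRing.Theory Num.Theory.
Local Open Scope ring_scope.

Section Lattice.
Variable d : nat.

Definition vertex := {ffun 'I_d -> int}.

(* a directed nearest-neighbour edge: (u, i, b) goes from u to u + e_i (b =
   true) or to u - e_i (b = false).  Every directed edge has exactly one such
   representation. *)
Definition edge := (vertex * 'I_d * bool)%type.

Definition eu (e : edge) : vertex := e.1.1.
Definition ev (e : edge) : vertex :=
  [ffun k => e.1.1 k + (if k == e.1.2 then (if e.2 then 1 else -1) else 0)].
Definition einv (e : edge) : edge := (ev e, e.1.2, ~~ e.2).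

Fixpoint lexlt (s t : seq int) : bool :=
  match s, t with
  | x :: s', y :: t' => (x < y) || ((x == y) && lexlt s' t')
  | _, _ => false
  end.
Definition vlt (x y : vertex) : bool :=
  lexlt [seq x i | i <- enum 'I_d] [seq y i | i <- enum 'I_d].

Definition positive (e : edge) : bool := vlt (eu e) (ev e).

Definition within1 (w w' : vertex) : bool :=
  (\sum_(i < d) `|w i - w' i| <= 1)%R.

Fixpoint chain (p : seq edge) : bool :=
  match p with
  | e1 :: ((e2 :: _) as p') => (ev e1 == eu e2) && chain p'
  | _ => true
  end.
Definition closed (p : seq edge) : bool :=
  chain p && (if p is e :: _ then ev (last e p) == eu e else true).

Fixpoint nbt (p : seq edge) : bool :=
  match p with
  | e1 :: ((e2 :: _) as p') => (e2 != einv e1) && nbt p'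
  | _ => true
  end.
(* a loop (represented by any closed path of its cycle class): a closed
   path with no backtrack, including the cyclic one at n *)
Definition is_loop (p : seq edge) : bool :=
  [&& closed p, nbt p & (if p is e :: _ then e != einv (last e p) else true)].

Fixpoint erase_lin (p : seq edge) : option (seq edge) :=
  match p with
  | e1 :: ((e2 :: p'') as p') =>
      if e2 == einv e1 then Some p'' else omap (cons e1) (erase_lin p')
  | _ => None
  end.
Definition erase1 (p : seq edge) : option (seq edge) :=
  match erase_lin p with
  | Some q => Some q
  | None => match p with
            | e :: p' => if e == einv (last e p') then Some (behead (belast e p'))
                         else None
            | [::] => None
            end
  end.
(* nonbacktracking core [l] (a representative of it); each erasure removes
   two edges, so size p steps suffice *)
Definition core (p : seq edge) : seq edge :=
  iter (size p) (fun q => odflt q (erase1 q)) p.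

Definition pinv (p : seq edge) : seq edge := rev (map einv p).

Definition loc (l : seq edge) : seq (nat * edge) := zip (iota 0 (size l)) l.
Definition idx (s : seq (seq edge)) : seq (nat * seq edge) :=
  zip (iota 0 (size s)) s.

(* ---- mergers: l has ex at x, l' has ey at y, ey = ex or ey = ex^-1 ---- *)
Definition merge_pos (l l' : seq edge) (x : nat) (ex : edge) (y : nat) (ey : edge)
  : seq edge :=
  let a := take x l in let b := drop x.+1 l in
  let c := take y l' in let dd := drop y.+1 l' in
  if ey == ex then core (a ++ ex :: dd ++ c ++ ex :: b)
  else core (a ++ ex :: pinv c ++ pinv dd ++ ex :: b).
Definition merge_neg (l l' : seq edge) (x : nat) (ex : edge) (y : nat) (ey : edge)
  : seq edge :=
  let a := take x l in let b := drop x.+1 l in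
  let c := take y l' in let dd := drop y.+1 l' in
  if ey == ex then core (a ++ pinv c ++ pinv dd ++ b)
  else core (a ++ dd ++ c ++ b).
Definition related (ex ey : edge) : bool := (ey == ex) || (ey == einv ex).

(* ---- splittings / twistings at distinct locations x, y of l.  We rotate l
   so that location x comes first: rot x l = ex :: b ++ ey :: c, so that
   l = a ex b ey c as a cycle with c ++ a = c (a empty). ---- *)
Definition rel_pos (l : seq edge) (x y : nat) : nat := ((y + size l - x) %% size l)%N.
Definition part_b (l : seq edge) (x y : nat) : seq edge :=
  take (rel_pos l x y).-1 (behead (rot x l)).
Definition part_c (l : seq edge) (x y : nat) : seq edge :=
  drop (rel_pos l x y).+1 (rot x l).
(* same edge e at x and y: l = a e b e c *)
Definition split1_same l x y (e : edge) := core (e :: part_c l x y).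
Definition split2_same l x y (e : edge) := core (part_b l x y ++ [:: e]).
Definition twist_same l x y := core (pinv (part_b l x y) ++ part_c l x y).
(* e at x, e^-1 at y: l = a e b e^-1 c *)
Definition split1_inv l x y := core (part_c l x y).
Definition split2_inv l x y := core (part_b l x y).
Definition twist_inv l x y (e : edge) :=
  core (e :: pinv (part_b l x y) ++ einv e :: part_c l x y).

Definition is_plaquette (p : seq edge) : bool := (size p == 4)%N && is_loop p.
Definition pplus_cond (p : seq edge) : bool :=
  if p is e1 :: _ then
    let vs := [seq eu e | e <- p] in
    all (fun w => (w == eu e1) || vlt (eu e1) w) vs &&
    all (fun w => (w == eu e1) || (w == ev e1) || vlt (ev e1) w) vs
  else false.
(* all directed edges with both endpoints in the (duplicate-free) list V *)
Definition edges_in (V : seq vertex) : seq edge :=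
  [seq e <- flatten [seq [seq (w, ib.1, ib.2) | ib <- allpairs pair (enum 'I_d) [:: true; false]]
                       | w <- V]
     | ev e \in V].
Definition paths4 (E : seq edge) : seq (seq edge) :=
  flatten [seq flatten [seq flatten [seq [seq [:: e1; e2; e3; e4] | e4 <- E]
     | e3 <- E] | e2 <- E] | e1 <- E].
Definition Pplus_in (V : seq vertex) : seq (seq edge) :=
  [seq p <- paths4 (edges_in V) | is_plaquette p && pplus_cond p].
Definition Eplus_in (V : seq vertex) : seq edge :=
  [seq e <- edges_in V | positive e].
(* vertices within distance one of u(e) or v(e): every plaquette containing
   e or e^-1 has all its vertices there *)
Definition nbhd (w : vertex) : seq vertex :=
  w :: [seq [ffun k => w k + (if k == i then (if b then 1 else -1) else 0)]
          | i <- enum 'I_d, b <- [:: true; false]].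
Definition Pplus_at (e : edge) : seq (seq edge) :=
  [seq p <- Pplus_in (undup (nbhd (eu e) ++ nbhd (ev e)))
     | (e \in p) || (einv e \in p)].

(*  Operations on loop sequences (with multiplicity, as lists)               *)
Definition replace_at (s : seq (seq edge)) (k : nat) (L : seq (seq edge)) :=
  take k s ++ L ++ drop k.+1 s.

Definition single_ops
  (F : seq edge -> nat -> edge -> nat -> edge -> seq (seq (seq edge)))
  (s : seq (seq edge)) : seq (seq (seq edge)) :=
  flatten [seq flatten [seq flatten
     [seq [seq replace_at s kl.1 L | L <- F kl.2 xe.1 xe.2 yf.1 yf.2]
       | yf <- loc kl.2] | xe <- loc kl.2] | kl <- idx s].

Definition Tminus := single_ops (fun l x ex y ey =>
  if (x != y) && (ey == ex) then [:: [:: twist_same l x y]] else [::]).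
Definition Tplus := single_ops (fun l x ex y ey =>
  if (x != y) && (ey == einv ex) then [:: [:: twist_inv l x y ex]] else [::]).
Definition Splus := single_ops (fun l x ex y ey =>
  if (x != y) && (ey == ex) then [:: [:: split1_same l x y ex; split2_same l x y ex]]
  else [::]).
Definition Sminus := single_ops (fun l x ex y ey =>
  if (x != y) && (ey == einv ex) then [:: [:: split1_inv l x y; split2_inv l x y]]
  else [::]).

Definition merge_into (s : seq (seq edge)) (k r : nat) (m : seq edge) :=
  [seq (if il.1 == k then m else il.2) | il <- idx s & il.1 != r].
Definition merger_ops
  (op : seq edge -> seq edge -> nat -> edge -> nat -> edge -> seq edge)
  (s : seq (seq edge)) : seq (seq (seq edge)) :=
  flatten [seq flatten [seq flatten [seq flatten
    [seq (if (kl.1 != rl.1) && related xe.2 yf.2 then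
            [:: merge_into s kl.1 rl.1 (op kl.2 rl.2 xe.1 xe.2 yf.1 yf.2)]
          else [::])
      | yf <- loc rl.2] | xe <- loc kl.2] | rl <- idx s] | kl <- idx s].
Definition Mplus := merger_ops merge_pos.
Definition Mminus := merger_ops merge_neg.

Definition deform_ops
  (op : seq edge -> seq edge -> nat -> edge -> nat -> edge -> seq edge)
  (s : seq (seq edge)) : seq (seq (seq edge)) :=
  flatten [seq flatten [seq flatten [seq flatten
    [seq (if related xe.2 yf.2 then [:: replace_at s kl.1 [:: op kl.2 p xe.1 xe.2 yf.1 yf.2]]
          else [::])
      | yf <- loc p] | p <- Pplus_at xe.2] | xe <- loc kl.2] | kl <- idx s].
Definition Dplus := deform_ops merge_pos.
Definition Dminus := deform_ops merge_neg.

Definition seq_len (s : seq (seq edge)) : nat := sumn (map size s).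

End Lattice.

Section Gauge.
Variables (R : realType) (N : nat).

Definition SOpred (M : 'M[R]_N) : bool := (M^T *m M == 1%:M) && (\det M == 1).
Record SO := mkSO { soval :> 'M[R]_N; soP : SOpred soval }.
HB.instance Definition _ := [isSub for soval].
HB.instance Definition _ := [Choice of SO by <:].

Lemma SOpred1 : SOpred 1%:M.
Proof. by rewrite /SOpred trmx1 mul1mx det1 !eqxx. Qed.
HB.instance Definition _ := isPointed.Build SO (mkSO SOpred1).

Lemma SOpredM (g h : SO) : SOpred (soval g *m soval h).
Proof.
case: g h => g /andP[/eqP gg /eqP dg] [h /andP[/eqP hh /eqP dh]] /=.
rewrite /SOpred trmx_mul mulmxA -(mulmxA h^T) gg mulmx1 hh eqxx /=.
by rewrite det_mulmx dg dh mulr1.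
Qed.
Definition SOmul (g h : SO) : SO := mkSO (SOpredM g h).

(* the sigma-algebra generated by the matrix-entry functions (= the Borel
   sigma-algebra of SO(N) as a subspace of R^(N*N)) *)
Definition SOgen : set (set SO) :=
  [set A | exists (i j : 'I_N) (B : set R), measurable B /\
           A = [set Q : SO | B (soval Q i j)]]%classic.
Definition SOm := g_sigma_algebraType SOgen.

Definition is_haar (sigma : probability SOm R) : Prop :=
  forall (g : SO) (A : set SOm), measurable A ->
    sigma [set Q : SOm | A (SOmul g Q)]%classic = sigma A.

Variable d : nat.
Variable sigma : probability SOm R.

(* configurations: Q_e for positively oriented e; Q_{e^-1} = Q_e^-1 = Q_e^T *)
Definition config := edge d -> 'M[R]_N.
Definition Qof (c : config) (e : edge d) : 'M[R]_N :=
  if positive e then c e else (c (einv e))^T.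
(* Wilson loop variable W_l = Tr(Q_e1 ... Q_en), W_null = Tr 1 = N *)
Definition Wl (c : config) (l : seq (edge d)) : R :=
  \tr (foldr (fun e M => Qof c e *m M) 1%:M l).
Definition Wprod (c : config) (s : seq (seq (edge d))) : R :=
  \prod_(l <- s) Wl c l.

Definition upd (c : config) (e : edge d) (M : 'M[R]_N) : config :=
  fun e' => if e' == e then M else c e'.
Fixpoint iint (es : seq (edge d)) (F : config -> R) (c : config) : R :=
  match es with
  | [::] => F c
  | e :: es' => Rintegral sigma setT (fun Q : SOm => iint es' F (upd c e (soval Q)))
  end.
Definition config0 : config := fun _ => 1%:M.

Variables (Lambda : seq (vertex d)) (beta : R).
Definition gauge_weight (c : config) : R :=
  expR (N%:R * beta * \sum_(p <- Pplus_in (undup Lambda)) Wl c p).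
Definition expect (F : config -> R) : R :=
  iint (Eplus_in (undup Lambda)) (fun c => F c * gauge_weight c) config0
  / iint (Eplus_in (undup Lambda)) gauge_weight config0.
(* phi(s) = <W_l1 ... W_ln> / N^n (null loops contribute N / N = 1) *)
Definition phi (s : seq (seq (edge d))) : R :=
  expect (fun c => Wprod c s) / N%:R ^+ size s.

End Gauge.

(* Main.v *)
Require Import Defs.
From HB Require Import structures.
From mathcomp Require Import all_boot all_order all_algebra.
From mathcomp Require Import all_classical all_reals all_analysis.
From mathcomp Require Import measurable_realfun.
From mathcomp Require Import zify ring lra.
Set Implicit Arguments. Unset Strict Implicit. Unset Printing Implicit Defensive.
Import Order.TTheory GRing.Theory Num.Theory.
Local Open Scope ring_scope.

(** Fix a loop [l_k] of [s] and a location [x] of it, carrying the edge [e]; let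
   [e0] be the positive one of [e] and [e^-1].  For a skew-symmetric [X], insert
   [X] in the trace of [l_k] next to the letter at [x] and multiply by the other
   Wilson loops and by the Gibbs weight.  Left invariance of the Haar measure
   in the variable [Q_e0] makes the integral of the derivative of this function in the
   direction [X] vanish.  Now sum over [X = E_ij - E_ji].  Since
   [sum_ij X_ab X_cd = 2 (d_ac d_bd - d_ad d_bc)], the derivative falling on the letter
   at [x] gives [-2 (N - 1)] times the original product, on another letter of
   [l_k] the twistings and splittings, on another loop the mergers, and on the
   weight the deformations.  Summing over [k] and [x] yields the equation.

   The iterated integral only sees SO(N)-valued configurations, on which every
   function involved is measurable and bounded. *)

(** * Iterated Haar integrals of bounded measurable functions *)

Section Configurations.
Variables (R : realType) (N d : nat).
Notation SO := (SO R N).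

(** Nothing is differentiated under the integral sign. A derivative [F'] of [F] means a uniform
    estimate [|F(g(t) c) - F(c) - t F'(c)| <= K t^2] for [0 <= t <= 1]. Integrated, the first two
    terms cancel by invariance under the single element [g(t)], so [|t I(F')| <= K t^2], and
    [I(F') = 0] since [t] is arbitrary. Hence the curve [g] only has to agree with [1 + t X] up to
    [O(t^2)]: no exponential or one-parameter group is needed, and an explicit algebraic curve of
    rotations serves.

    The differentiated function already contains [X] once, as the part of the variation of [W_l]
    that comes from the letter at [x]. Every term of its derivative therefore contains [X] exactly
    twice, which is what the sum over [i, j] contracts. The factor 2 of the contraction is common to
    all terms and is divided out.

    The operations on loops are recognised on matrix words before any backtrack is erased, since
    passing to the core does not change a trace. *)

Definition soconf := edge d -> SO.

(** The product sigma-algebra, generated directly by matrix entries: a map into configurations is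
    measurable once every entry of every edge variable is. *)
Definition soconf_gen : set (set soconf) :=
  [set A | exists (e : edge d) (i j : 'I_N) (B : set R), measurable B /\
           A = [set c : soconf | B (soval (c e) i j)]]%classic.
Definition soconfm := g_sigma_algebraType soconf_gen.

Definition matconf (c : soconf) : config R N d := fun e => soval (c e).

Definition soupd (c : soconf) (e : edge d) (Q : SO) : soconf :=
  fun e' => if e' == e then Q else c e'.

Lemma matconf_upd (c : soconf) e (Q : SO) :
  upd (matconf c) e (soval Q) = matconf (soupd c e Q).
Proof. by apply/funext => e'; rewrite /upd /matconf /soupd; case: ifP. Qed.

Lemma measurable_fun_SOentry (i j : 'I_N) :
  measurable_fun setT (fun Q : SOm R N => soval Q i j).
Proof.
move=> _ B mB; rewrite setTI; apply: sub_sigma_algebra.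
by exists i, j, B.
Qed.

Lemma measurable_fun_confentry (e : edge d) (i j : 'I_N) :
  measurable_fun setT (fun c : soconfm => soval (c e) i j).
Proof.
move=> _ B mB; rewrite setTI; apply: sub_sigma_algebra.
by exists e, i, j, B.
Qed.

Lemma measurable_fun_toSO disp (T : measurableType disp) (f : T -> SOm R N) :
  (forall i j, measurable_fun setT (fun x => soval (f x) i j)) ->
  measurable_fun setT f.
Proof.
move=> mf; apply: (measurability (@SOgen R N : set (set (SOm R N)))) => //.
move=> _ [_ [i [j [B [mB ->]]]] <-].
by have := mf i j measurableT B mB.
Qed.

Lemma measurable_fun_toconf disp (T : measurableType disp) (f : T -> soconfm) :
  (forall e i j, measurable_fun setT (fun x => soval (f x e) i j)) ->
  measurable_fun setT f.
Proof.
move=> mf; apply: (measurability (soconf_gen : set (set soconfm))) => //.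
move=> _ [_ [e [i [j [B [mB ->]]]]] <-].
by have := mf e i j measurableT B mB.
Qed.

Lemma measurable_soupd (e : edge d) :
  measurable_fun setT
    (fun cQ : soconfm * SOm R N => soupd cQ.1 e cQ.2 : soconfm).
Proof.
apply: measurable_fun_toconf => e' i j; rewrite /soupd; case: (e' == e).
- exact: (measurableT_comp (measurable_fun_SOentry i j) measurable_snd).
- exact: (measurableT_comp (measurable_fun_confentry e' i j) measurable_fst).
Qed.

Lemma measurable_SOmul (g : SO) :
  measurable_fun setT (fun Q : SOm R N => SOmul g Q : SOm R N).
Proof.
apply: measurable_fun_toSO => i j /=.
under eq_fun do rewrite mxE.
apply: measurable_sum => k; apply: measurable_funM => //.
exact: measurable_fun_SOentry.
Qed.

(** A class stable under sums, products, exponentials and integration in one variable. As [sigma] is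
    a probability, its members are integrable in each variable. *)
Definition bm (F : soconf -> R) : Prop :=
  measurable_fun setT (F : soconfm -> R) /\ exists C, forall c, `|F c| <= C.

Lemma bm_cst (a : R) : bm (fun=> a).
Proof. by split; [exact: measurable_cst|exists `|a|]. Qed.

Lemma bm_add F G : bm F -> bm G -> bm (fun c => F c + G c).
Proof.
move=> [mF [C hC]] [mG [D hD]]; split; first exact: measurable_funD.
by exists (C + D) => c; rewrite (le_trans (ler_normD _ _)) ?lerD.
Qed.

Lemma bm_mul F G : bm F -> bm G -> bm (fun c => F c * G c).
Proof.
move=> [mF [C hC]] [mG [D hD]]; split; first exact: measurable_funM.
by exists (C * D) => c; rewrite normrM ler_pM.
Qed.

Lemma bm_sum (I : Type) (r : seq I) (F : I -> soconf -> R) :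
  (forall i, bm (F i)) -> bm (fun c => \sum_(i <- r) F i c).
Proof.
move=> bF; elim: r => [|i r IH].
  by under eq_fun do rewrite big_nil; exact: bm_cst.
by under eq_fun do rewrite big_cons; exact: bm_add.
Qed.

Lemma bm_prod (I : Type) (r : seq I) (F : I -> soconf -> R) :
  (forall i, bm (F i)) -> bm (fun c => \prod_(i <- r) F i c).
Proof.
move=> bF; elim: r => [|i r IH].
  by under eq_fun do rewrite big_nil; exact: bm_cst.
by under eq_fun do rewrite big_cons; exact: bm_mul.
Qed.

Lemma bm_expR F : bm F -> bm (fun c => expR (F c)).
Proof.
move=> [mF [C hC]]; split; first exact: measurableT_comp (@measurable_expR R) mF.
exists (expR C) => c; rewrite ger0_norm ?expR_ge0 // ler_expR.
exact: le_trans (ler_norm _) (hC c).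
Qed.

Lemma SO_trmx_mul (Q : SO) : (soval Q)^T *m soval Q = 1%:M.
Proof. by have /andP[/eqP] := soP Q. Qed.

Lemma SO_mul_trmx (Q : SO) : soval Q *m (soval Q)^T = 1%:M.
Proof. exact: mulmx1C (SO_trmx_mul Q). Qed.

(** The squares of the entries of column [j] add up to the diagonal entry [(j, j)] of
    [Q^T Q = 1]. *)
Lemma SO_entry_le1 (Q : SO) i j : `|soval Q i j| <= 1.
Proof.
have := congr1 (fun M : 'M[R]_N => M j j) (SO_trmx_mul Q).
rewrite !mxE eqxx (bigD1 i) //= !mxE mulr1n => h.
rewrite -(@expr_le1 _ 2) // real_normK ?num_real // expr2 -h lerDl.
by apply: sumr_ge0 => k _; rewrite !mxE -expr2 sqr_ge0.
Qed.

Lemma bm_entry e i j : bm (fun c => soval (c e) i j).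
Proof.
by split; [exact: measurable_fun_confentry|exists 1 => c; exact: SO_entry_le1].
Qed.

Variable sigma : probability (SOm R N) R.

Fixpoint soint (es : seq (edge d)) (F : soconf -> R) (c : soconf) : R :=
  match es with
  | [::] => F c
  | e :: es' => Rintegral sigma setT (fun Q : SOm R N => soint es' F (soupd c e Q))
  end.

(** Transfers the integrals of the statement to SO(N)-valued configurations; the starting
    configuration [config0] is [matconf] of the constant identity. *)
Lemma iint_matconf es (F : config R N d -> R) (c : soconf) :
  iint sigma es F (matconf c) = soint es (F \o matconf) c.
Proof.
elim: es c => //= e es IH c; congr Rintegral.
by apply/funext => Q; rewrite matconf_upd IH.
Qed.

Lemma integrable_bounded (f : SOm R N -> R) C :
  measurable_fun setT f -> (forall Q, `|f Q| <= C) ->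
  sigma.-integrable setT (EFin \o f).
Proof.
move=> mf hC; apply: measurable_bounded_integrable => //.
  by rewrite (le_lt_trans (probability_le1 sigma measurableT)) ?ltry.
exists C; split; [exact: num_real|move=> M CM Q _ /=].
exact: le_trans (hC Q) (ltW CM).
Qed.

Lemma normr_Rintegral_bounded (f : SOm R N -> R) C :
  measurable_fun setT f -> (forall Q, `|f Q| <= C) ->
  `|Rintegral sigma setT f| <= C.
Proof.
move=> mf hC; have fi := integrable_bounded mf hC.
rewrite (le_trans (le_normr_Rintegral measurableT fi)) //.
have -> : C = \int[sigma]_(Q in setT) (cst C Q).
  by rewrite Rintegral_cst //= probability_setT mulr1.
apply: le_Rintegral => //.
- apply: (@integrable_bounded (fun Q => `|f Q|) C).
    exact: measurableT_comp mf.
  by move=> Q; rewrite normr_id.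
- exact: (@integrable_bounded (cst C) `|C|).
Qed.

Lemma bm_section F c e : bm F ->
  measurable_fun setT (fun Q : SOm R N => F (soupd c e Q)).
Proof.
move=> [mF _]; apply: (measurableT_comp mF).
exact: (measurableT_comp (measurable_soupd e) (pair1_measurable (c : soconfm))).
Qed.

Lemma bm_integrable F c e : bm F ->
  sigma.-integrable setT (EFin \o (fun Q : SOm R N => F (soupd c e Q))).
Proof.
move=> bF; have [_ [C hC]] := bF.
by apply: (@integrable_bounded _ C) => //; exact: bm_section.
Qed.

(** Measurability in the remaining variables comes from Tonelli applied to [F + C], which is
    nonnegative when [C] bounds [|F|]; since [sigma] has mass 1, [C] is subtracted afterwards. *)
Lemma bm_Rintegral F e : bm F ->
  bm (fun c => Rintegral sigma setT (fun Q : SOm R N => F (soupd c e Q))).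
Proof.
move=> bF; have [mF [C hC]] := bF; split; last first.
  exists C => c; apply: normr_Rintegral_bounded => //; exact: bm_section.
pose H (cQ : soconfm * SOm R N) := ((F (soupd cQ.1 e cQ.2) + C)%:E).
have H0 x : (0 <= H x)%E.
  rewrite lee_fin -lerBlDr sub0r.
  by have := hC (soupd x.1 e x.2); rewrite ler_norml => /andP[].
have mH : measurable_fun setT H.
  apply/measurable_EFinP; apply: measurable_funD => //.
  exact: (measurableT_comp mF (measurable_soupd e)).
have mI := measurable_fun_fubini_tonelli_F (m2 := sigma) H mH H0.
have -> : (fun c : soconfm =>
     Rintegral sigma setT (fun Q : SOm R N => F (soupd c e Q))) =
   (fun c : soconfm => fine (fubini_F sigma H c) - C).
  apply/funext => c; rewrite /fubini_F /H /=.
  have -> : fine (\int[sigma]_y (F (soupd c e y) + C)%:E) =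
    \int[sigma]_(y in setT) (F (soupd c e y) + C) by [].
  rewrite RintegralD //; last 2 first.
  - exact: bm_integrable.
  - exact: (@integrable_bounded (cst C) `|C|).
  by rewrite Rintegral_cst //= probability_setT mulr1 addrK.
apply: measurable_funB => //.
exact: measurableT_comp mI.
Qed.

Lemma bm_soint es F : bm F -> bm (soint es F).
Proof. by move=> bF; elim: es => //= e es IH; exact: bm_Rintegral. Qed.

Lemma sointD es F G c : bm F -> bm G ->
  soint es (fun c => F c + G c) c = soint es F c + soint es G c.
Proof.
move=> bF bG; elim: es c => //= e es IH c.
rewrite -RintegralD //; try by apply: bm_integrable; exact: bm_soint.
by congr Rintegral; apply/funext => Q; rewrite IH.
Qed.

Lemma sointZ es a F c : bm F ->
  soint es (fun c => a * F c) c = a * soint es F c.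
Proof.
move=> bF; elim: es c => //= e es IH c.
rewrite -RintegralZl //; last by apply: bm_integrable; exact: bm_soint.
by congr Rintegral; apply/funext => Q; rewrite IH.
Qed.

Lemma soint_sum (I : Type) (r : seq I) es (F : I -> soconf -> R) c :
  (forall i, bm (F i)) ->
  soint es (fun c => \sum_(i <- r) F i c) c = \sum_(i <- r) soint es (F i) c.
Proof.
move=> bF; elim: r => [|i r IH].
  rewrite big_nil (_ : (fun c0 => _) = (fun c0 : soconf => 0 * (fun=> 0) c0)).
    by rewrite sointZ ?mul0r //; exact: bm_cst.
  by apply/funext => c0; rewrite big_nil mul0r.
rewrite big_cons -IH -sointD //; last exact: bm_sum.
by under [X in soint es X]eq_fun do rewrite big_cons.
Qed.

Lemma soint_le es F K c : bm F -> (forall c, `|F c| <= K) -> `|soint es F c| <= K.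
Proof.
move=> bF hK; elim: es c => //= e es IH c.
apply: normr_Rintegral_bounded => //.
by apply: bm_section; exact: bm_soint.
Qed.

Definition lmul (e : edge d) (g : SO) (c : soconf) : soconf :=
  soupd c e (SOmul g (c e)).

Lemma soupd_lmul e g c e' Q : e' != e ->
  soupd (lmul e g c) e' Q = lmul e g (soupd c e' Q).
Proof.
move=> ne; apply/funext => f; rewrite /lmul /soupd.
rewrite (eq_sym e e') (negPf ne); case: (eqVneq f e') => // ->.
by rewrite (negPf ne).
Qed.

Lemma soupd_lmul_same e g c Q : lmul e g (soupd c e Q) = soupd c e (SOmul g Q).
Proof. by apply/funext => f; rewrite /lmul /soupd eqxx; case: (f == e). Qed.

Lemma measurable_lmul e g :
  measurable_fun setT (fun c : soconfm => lmul e g c : soconfm).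
Proof.
apply: measurable_fun_toconf => e' i j; rewrite /lmul /soupd.
case: (e' == e) => /=; last exact: measurable_fun_confentry.
apply: (eq_measurable_fun (fun c : soconfm =>
    \sum_k soval g i k * soval (c e) k j)).
  by move=> c _; rewrite mxE.
apply: measurable_sum => k; apply: measurable_funM => //.
exact: measurable_fun_confentry.
Qed.

Lemma bm_lmul e g F : bm F -> bm (F \o lmul e g).
Proof.
move=> [mF [C hC]]; split; last by exists C => c; exact: hC.
exact: (measurableT_comp mF (measurable_lmul e g)).
Qed.

Lemma soint_lmul_notin es e g F c : e \notin es ->
  soint es (F \o lmul e g) c = soint es F (lmul e g c).
Proof.
elim: es c => //= e1 es IH c; rewrite inE negb_or => /andP[ne ni].
congr Rintegral; apply/funext => Q.
by rewrite IH // soupd_lmul // eq_sym.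
Qed.

Hypothesis haar : is_haar sigma.

Lemma Rintegral_haar (g : SO) (f : SOm R N -> R) C :
  measurable_fun setT f -> (forall Q, `|f Q| <= C) ->
  Rintegral sigma setT (fun Q => f (SOmul g Q)) = Rintegral sigma setT f.
Proof.
move=> mf hC; rewrite /Rintegral; congr fine.
have mg := measurable_SOmul g.
have -> : (\int[sigma]_(x in setT) (f x)%:E =
   \int[pushforward sigma (fun Q : SOm R N => SOmul g Q : SOm R N)]_(x in setT) (f x)%:E)%E.
  apply: eq_measure_integral => A mA _.
  exact/esym/haar.
rewrite integral_pushforward //=.
- exact/measurable_EFinP.
- apply: (@integrable_bounded (fun Q => f (SOmul g Q)) C) => //.
  exact: (measurableT_comp mf (measurable_SOmul g)).
Qed.

(** Invariance is used at the innermost integration over [e]: the integrals inside it concern other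
    edges and commute with the translation, and those outside it only see an inner integral that is
    already invariant. *)
Lemma soint_lmul es e g F c : bm F -> e \in es ->
  soint es (F \o lmul e g) c = soint es F c.
Proof.
move=> bF; elim: es c => //= e1 es IH c.
have [ein _|nin] := boolP (e \in es).
  by congr Rintegral; apply/funext => Q; rewrite IH.
rewrite inE (negPf nin) orbF => /eqP<-.
have bs := bm_soint es bF; have [_ [C hC]] := bs.
rewrite -(@Rintegral_haar g (fun Q : SOm R N => soint es F (soupd c e Q)) C) //;
  last exact: bm_section.
congr Rintegral; apply/funext => Q.
by rewrite soint_lmul_notin // soupd_lmul_same.
Qed.

End Configurations.

(** * Rotations in a coordinate plane *)

Section Rotations.
Variables (R : realType) (N : nat).

Definition skew_delta (i j : 'I_N) : 'M[R]_N := delta_mx i j - delta_mx j i.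

Lemma trmx_skew_delta i j : (skew_delta i j)^T = - skew_delta i j.
Proof. by rewrite /skew_delta linearB /= !trmx_delta opprB. Qed.

(** For [i != j], [X] is a quarter turn of the plane of coordinates [i] and [j], so [X^2] is minus
    the projection onto that plane; for [i = j], [X = 0]. *)
Lemma skew_delta_cube i j (X := skew_delta i j) : X *m X *m X = - X.
Proof.
rewrite /X /skew_delta; have [<-|ne] := eqVneq i j.
  by rewrite subrr !mulmx0 oppr0.
have nf : (j == i) = false by rewrite eq_sym (negPf ne).
by rewrite !(mulmxBl, mulmxBr) !mul_delta_mx_cond !eqxx (negPf ne) nf
  !(mulr0n, mulr1n, mul0mx, sub0r, subr0, mulmxBl, mulNmx, mulmxN)
  !mul_delta_mx_cond !eqxx ?(negPf ne) ?nf
  !(mulr0n, mulr1n, oppr0, subr0, sub0r, opprK, addr0, add0r) opprB addrC.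
Qed.

(** When [X^3 = -X], the choice [p = sin u], [q = 1 - cos u] gives [exp(u X)]; all such quadratic
    polynomials in [X] are stable under products. *)
Definition skew_rot (X : 'M[R]_N) (p q : R) : 'M[R]_N := 1%:M + p *: X + q *: (X *m X).

Lemma skew_rotM X p q p' q' : X *m X *m X = - X ->
  skew_rot X p q *m skew_rot X p' q' =
  skew_rot X (p + p' - p * q' - q * p') (q + q' + p * p' - q * q').
Proof.
move=> X3; have X3' : X *m (X *m X) = - X by rewrite mulmxA.
have X4 : X *m X *m (X *m X) = - (X *m X) by rewrite mulmxA X3 mulNmx.
rewrite /skew_rot !(mulmxDl, mulmxDr) !mul1mx !mulmx1.
rewrite -!scalemxAl -!scalemxAr X3 X3' X4.
rewrite !scalerDl !scalerA !scalerN !scaleNr.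
apply/matrixP => k l; rewrite !mxE; ring.
Qed.

Lemma trmx_skew_rot X p q : X^T = - X -> (skew_rot X p q)^T = skew_rot X (- p) q.
Proof.
move=> XT; rewrite /skew_rot !linearD /= !linearZ /= trmx1 trmx_mul XT.
by rewrite mulmxN mulNmx opprK scalerN scaleNr.
Qed.

(* The square root [skew_rot X b (1 - a)] of the rotation only has determinant
   [+-1] a priori; squaring it makes the determinant 1. *)
Lemma SOpred_skew_rot X (a b : R) : X^T = - X -> X *m X *m X = - X ->
  a ^+ 2 + b ^+ 2 = 1 -> SOpred (skew_rot X (2 * a * b) (2 * b ^+ 2)).
Proof.
move=> XT X3 ab; pose A := skew_rot X b (1 - a).
have AA : A *m A = skew_rot X (2 * a * b) (2 * b ^+ 2).
  rewrite skew_rotM //; congr skew_rot; first by ring.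
  by move: ab; lra.
have ATA : A^T *m A = 1%:M.
  rewrite trmx_skew_rot // skew_rotM //.
  have -> : - b + b - - b * (1 - a) - (1 - a) * b = 0 by ring.
  have -> : 1 - a + (1 - a) + - b * b - (1 - a) * (1 - a) = 0 by move: ab; lra.
  by rewrite /skew_rot !scale0r !addr0.
rewrite /SOpred -AA trmx_mul mulmxA -(mulmxA A^T) ATA mulmx1 ATA eqxx /=.
by rewrite det_mulmx -{1}det_tr -det_mulmx ATA det1.
Qed.

(** The curve is parametrised by the half-angle: its sine is [b = t / 2] and its cosine is [a]. Then
    the sine of the full angle is [2 a b = t a], and one minus its cosine is [2 b^2 = t^2 / 2]. The
    error is [-t (1 - a) X + 2 b^2 X^2], quadratic in [t] because [1 - a <= 1 - a^2 = b^2]. *)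
Lemma skew_delta_tangent i j : exists (g : R -> SO R N) (K : R),
  forall t k l, 0 <= t <= 1 ->
  `|soval (g t) k l - (1%:M k l + t * skew_delta i j k l)| <= K * t ^+ 2.
Proof.
pose X := skew_delta i j; pose b (t : R) := t / 2.
pose a t := Num.sqrt (1 - b t ^+ 2).
have ab t : 0 <= t <= 1 -> a t ^+ 2 + b t ^+ 2 = 1.
  move=> t01; rewrite sqr_sqrtr ?subrK // /b; nra.
pose M t := skew_rot X (2 * a t * b t) (2 * b t ^+ 2).
have SOM t : 0 <= t <= 1 -> SOpred (M t).
  by move=> /ab; apply: SOpred_skew_rot; [exact: trmx_skew_delta|exact: skew_delta_cube].
(* The identity is the default where [M t] is not in SO(N); this does not happen for [t] in
   [[0, 1]]. *)
pose g t : SO R N := insubd (mkSO (@SOpred1 R N)) (M t).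
pose K := \sum_k \sum_l (`|X k l| + `|(X *m X) k l|).
exists g, K => t k l t01.
rewrite /g (_ : soval _ = val (insubd (mkSO (@SOpred1 R N)) (M t))) // insubdK; last exact: SOM.
have at0 : 0 <= a t by exact: sqrtr_ge0.
have := ab _ t01 => abt.
have a1 : a t <= 1 by rewrite -(@ler_pXn2r _ 2) ?nnegrE // expr1n -abt lerDl sqr_ge0.
have ba : 0 <= 1 - a t <= b t ^+ 2.
  by rewrite subr_ge0 a1 /= -abt; nra.
have -> : M t k l - (1%:M k l + t * X k l) =
  - (t * (1 - a t)) * X k l + 2 * b t ^+ 2 * (X *m X) k l.
  by rewrite /M /skew_rot !mxE /b; field.
apply: (@le_trans _ _ (t ^+ 2 * (`|X k l| + `|(X *m X) k l|))).
  rewrite (le_trans (ler_normD _ _)) // [leRHS]mulrDr mulNr normrN.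
  have p1 : `|t * (1 - a t)| <= t ^+ 2.
    rewrite ger0_norm; last by apply: mulr_ge0; lra.
    rewrite expr2 ler_wpM2l //; first by lra.
    have : b t ^+ 2 <= t by rewrite /b; nra.
    by lra.
  have p2 : `|2| * `|b t ^+ 2| <= t ^+ 2.
    by rewrite -normrM ger0_norm /b; nra.
  by apply: lerD; rewrite [leLHS]normrM; apply: ler_wpM2r; rewrite // normrM.
rewrite mulrC ler_wpM2r ?sqr_ge0 //.
rewrite /K (bigD1 k) //= (bigD1 l) //= -addrA lerDl addr_ge0 //.
  by apply: sumr_ge0 => ? _; rewrite addr_ge0.
by apply: sumr_ge0 => ? _; apply: sumr_ge0 => ? _; rewrite addr_ge0.
Qed.

End Rotations.

(** * Differentiation along one-parameter rotations *)

Lemma expR_sub1_le (R : realType) (h : R) : expR h - 1 <= h * expR h.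
Proof.
have : (1 - h) * expR h <= 1.
  have := expR_ge1Dx (- h); rewrite expRN => h1.
  by rewrite -[leRHS](mulVf (lt0r_neq0 (expR_gt0 h))) ler_wpM2r ?expR_ge0.
lra.
Qed.

Section Derivation.
Variables (R : realType) (N d : nat).
Variables (e0 : edge d) (X : 'M[R]_N) (g : R -> SO R N) (Kg : R).
Hypothesis gX : forall t k l, 0 <= t <= 1 ->
  `|soval (g t) k l - (1%:M k l + t * X k l)| <= Kg * t ^+ 2.
Notation conf := (soconf R N d).

(* [F'] is the derivative of [F] along [c e0 |-> (1 + t X) c e0]; the uniform
   quadratic remainder lets it be integrated without exchanging limits. *)
Definition isder (F F' : conf -> R) : Prop :=
  [/\ bm F, bm F' & exists K, forall t c, 0 <= t <= 1 ->
    `|F (lmul e0 (g t) c) - F c - t * F' c| <= K * t ^+ 2].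

Lemma eq_isder F F' G G' : F =1 G -> F' =1 G' -> isder F F' -> isder G G'.
Proof. by move=> /funext-> /funext->. Qed.

Lemma isder_cst a : isder (fun=> a) (fun=> 0).
Proof.
split; [exact: bm_cst|exact: bm_cst|].
by exists 0 => t c _; rewrite subrr mulr0 subrr normr0 mul0r.
Qed.

Lemma isder_add F F' G G' : isder F F' -> isder G G' ->
  isder (fun c => F c + G c) (fun c => F' c + G' c).
Proof.
move=> [bF bF' [K hK]] [bG bG' [L hL]]; split; [exact: bm_add|exact: bm_add|].
exists (K + L) => t c t01; rewrite mulrDl.
rewrite (_ : _ - _ - _ = (F (lmul e0 (g t) c) - F c - t * F' c) +
  (G (lmul e0 (g t) c) - G c - t * G' c)); last by ring.
by rewrite (le_trans (ler_normD _ _)) // lerD ?hK ?hL.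
Qed.

(** The remainder of the product is exactly [t^2 F' G'], plus [F + t F'] times the remainder of [G],
    plus the remainder of [F] times the translated [G]. Boundedness of all the factors makes each
    piece [O(t^2)]. *)
Lemma isder_mul F F' G G' : isder F F' -> isder G G' ->
  isder (fun c => F c * G c) (fun c => F' c * G c + F c * G' c).
Proof.
move=> [bF bF' [K hK]] [bG bG' [L hL]]; split; [exact: bm_mul| |].
  by apply: bm_add; exact: bm_mul.
have [[_ [CF hF]] [_ [CF' hF']]] := (bF, bF').
have [[_ [CG hG]] [_ [CG' hG']]] := (bG, bG').
exists (CF' * CG' + (CF + CF') * L + K * CG) => t c t01.
set Ft := F (lmul e0 (g t) c); set Gt := G (lmul e0 (g t) c).
rewrite (_ : _ - _ - _ = t ^+ 2 * (F' c * G' c) +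
  (F c + t * F' c) * (Gt - G c - t * G' c) + (Ft - F c - t * F' c) * Gt); last by ring.
have t0 : `|t| <= 1 by rewrite ger0_norm; case/andP: t01.
rewrite [leRHS]mulrDl; apply: le_trans (ler_normD _ _) _; apply: lerD; last first.
  by rewrite normrM mulrAC ler_pM ?hK // /Gt.
rewrite [leRHS]mulrDl; apply: le_trans (ler_normD _ _) _; apply: lerD.
  rewrite normrM (ger0_norm (sqr_ge0 t)) mulrC ler_wpM2r ?sqr_ge0 //.
  by rewrite normrM ler_pM.
rewrite normrM -mulrA ler_pM ?hL //.
rewrite (le_trans (ler_normD _ _)) // lerD // normrM.
by rewrite -[CF']mul1r ler_pM.
Qed.

Lemma isder_sum (I : Type) (r : seq I) (F F' : I -> conf -> R) :
  (forall i, isder (F i) (F' i)) ->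
  isder (fun c => \sum_(i <- r) F i c) (fun c => \sum_(i <- r) F' i c).
Proof.
move=> hF; elim: r => [|i r IH].
  by apply: eq_isder (isder_cst 0) => c; rewrite big_nil.
by apply: eq_isder (isder_add (hF i) IH) => c; rewrite big_cons.
Qed.

(** Without repetitions in [r], the condition [j != i] omits exactly the differentiated factor. *)
Lemma isder_prod (I : eqType) (r : seq I) (F F' : I -> conf -> R) : uniq r ->
  (forall i, isder (F i) (F' i)) ->
  isder (fun c => \prod_(i <- r) F i c)
    (fun c => \sum_(i <- r) F' i c * \prod_(j <- r | j != i) F j c).
Proof.
move=> + hF; elim: r => [_|i r IH /= /andP[ni ur]].
  by apply: eq_isder (isder_cst 1) => c; rewrite big_nil.
apply: eq_isder (isder_mul (hF i) (IH ur)) => c; first by rewrite big_cons.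
rewrite big_cons big_cons eqxx /=; congr (_ * _ + _).
  rewrite big_seq [RHS]big_seq_cond; apply: eq_bigl => j.
  by case: (boolP (j \in r)) => //= jr; case: eqVneq jr ni => // -> ->.
rewrite mulr_sumr; apply: eq_big_seq => j jr.
have ij : i != j by apply: contraNneq ni => ->.
by rewrite big_cons ij mulrCA.
Qed.

(** From [e^h - 1 <= h e^h] one gets [0 <= e^h - 1 - h <= h (e^h - 1)]. The right side is at most
    [h^2 e^h] for [h >= 0], and at most [h^2] for [h <= 0] because [e^h - 1 >= h]. *)
Lemma expR_taylor (h : R) : `|expR h - 1 - h| <= h ^+ 2 * (1 + expR h).
Proof.
have e1 := expR_ge1Dx h; have e2 := expR_sub1_le h.
have e0' := expR_gt0 h.
rewrite ger0_norm; last by lra.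
have [h0|h0] := leP 0 h; nra.
Qed.

(** With [h] the increment of [F], the remainder is [e^F ((e^h - 1 - h) + (h - t F'))]. Since
    [|h| <= M t], the first part is controlled by [expR_taylor] and the second by the remainder of
    [F]. *)
Lemma isder_expR F F' : isder F F' ->
  isder (fun c => expR (F c)) (fun c => expR (F c) * F' c).
Proof.
move=> [bF bF' [K hK]]; split; [exact: bm_expR| |].
  by apply: bm_mul => //; exact: bm_expR.
have [[_ [CF hF]] [_ [CF' hF']]] := (bF, bF').
pose M := CF' + K.
exists (expR CF * (M ^+ 2 * (1 + expR M) + K)) => t c t01.
set Ft := F (lmul e0 (g t) c).
have := hK t c t01; rewrite -/Ft => hr.
pose h := Ft - F c.
have t0 : `|t| = t by rewrite ger0_norm; case/andP: t01.
have [t_ge0 t_le1] := andP t01.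
have K0 : 0 <= K.
  by have := le_trans (normr_ge0 _) (hK 1 c _); rewrite expr1n mulr1 ler01 lexx; apply.
have CF'0 : 0 <= CF' by exact: le_trans (normr_ge0 _) (hF' c).
have hM : `|h| <= M * t.
  rewrite (_ : h = t * F' c + (Ft - F c - t * F' c)); last by rewrite /h; ring.
  rewrite (le_trans (ler_normD _ _)) // mulrDl lerD //.
    by rewrite normrM t0 mulrC ler_wpM2r.
  by rewrite (le_trans hr) // ler_wpM2l // expr2; nra.
have M0 : 0 <= M by rewrite addr_ge0.
have h2 : h ^+ 2 <= M ^+ 2 * t ^+ 2.
  by rewrite -exprMn -(ger0_norm (sqr_ge0 h)) normrX lerXn2r ?nnegrE ?mulr_ge0.
have hexp : expR h <= expR M.
  rewrite ler_expR (le_trans (ler_norm _)) // (le_trans hM) //.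
  by rewrite -[leRHS]mulr1 ler_wpM2l.
have -> : expR Ft - expR (F c) - t * (expR (F c) * F' c) =
    expR (F c) * ((expR h - 1 - h) + (h - t * F' c)).
  have -> : expR Ft = expR (F c) * expR h by rewrite -expRD; congr expR; rewrite /h; ring.
  by ring.
rewrite normrM (ger0_norm (expR_ge0 _)) -mulrA ler_pM ?expR_ge0 //.
  by rewrite ler_expR (le_trans (ler_norm _)).
rewrite (le_trans (ler_normD _ _)) // mulrDl lerD //.
rewrite (le_trans (expR_taylor h)) // [leRHS]mulrAC.
by apply: ler_pM => //; rewrite ?sqr_ge0 ?addr_ge0 ?expR_ge0 ?lerD2l.
Qed.

(** The remainder is an entry of [(g(t) - 1 - t X) Q]: a sum of [N] terms, each at most [Kg t^2]
    because the entries of [Q] are at most 1 in absolute value. *)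
Lemma isder_moved k l :
  isder (fun c => soval (c e0) k l) (fun c => (X *m soval (c e0)) k l).
Proof.
have b1 m n : bm (fun c : conf => soval (c e0) m n) by exact: bm_entry.
have bX : bm (fun c : conf => (X *m soval (c e0)) k l).
  under eq_fun do rewrite mxE.
  rewrite (_ : (fun c => _) = (fun c : conf => \sum_(m <- enum 'I_N) X k m * soval (c e0) m l)).
    by apply: bm_sum => m; apply: bm_mul => //; exact: bm_cst.
  by apply/funext => c; rewrite big_enum.
split => //; exists (\sum_(m < N) Kg) => t c t01.
rewrite /lmul /soupd eqxx /=.
rewrite (_ : _ - _ - _ =
    \sum_m (soval (g t) k m - (1%:M k m + t * X k m)) * soval (c e0) m l).
  rewrite mulr_suml (le_trans (ler_norm_sum _ _ _)) //; apply: ler_sum => m _.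
  by rewrite normrM -[leRHS]mulr1 ler_pM ?gX ?SO_entry_le1.
rewrite -[X in _ - fun_of_matrix X k l - _](mul1mx (soval (c e0))) !mxE mulr_sumr -!sumrB.
by apply: eq_bigr => m _; ring.
Qed.

Lemma isder_unmoved e k l : e != e0 ->
  isder (fun c => soval (c e) k l) (fun=> 0).
Proof.
move=> ne; split; [exact: bm_entry|exact: bm_cst|].
exists 0 => t c _.
by rewrite /lmul /soupd (negPf ne) subrr mulr0 subrr normr0 mul0r.
Qed.

Variable sigma : probability (SOm R N) R.
Hypothesis haar : is_haar sigma.

(** By invariance, [t] times the integral of [F'] is minus the integral of the remainder, hence at
    most [K t^2] in absolute value. Dividing by [t] bounds the integral of [F'] by [K t] for every
    [t] in [(0, 1]]. *)
Lemma soint_isder (es : seq (edge d)) F F' c : isder F F' -> e0 \in es ->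
  soint sigma es F' c = 0.
Proof.
move=> [bF bF' [K hK]] e0in; set I' := soint _ _ _ _.
have small t : 0 < t <= 1 -> `|I'| <= K * t.
  move=> /andP[t0 t1]; rewrite -(ler_pM2l t0) mulrCA -expr2 -{1}(ger0_norm (ltW t0)) -normrM.
  have bFt := bm_lmul e0 (g t) bF.
  have bN G a : bm G -> bm (fun c : conf => a * G c).
    by move=> bG; apply: bm_mul => //; exact: bm_cst.
  have -> : t * I' = - soint sigma es
     (fun c => (F (lmul e0 (g t) c) + (- 1) * F c) + (- t) * F' c) c.
    rewrite sointD; [|by apply: bm_add => //; exact: bN|exact: bN].
    rewrite sointD //; last exact: bN.
    rewrite !sointZ // (soint_lmul haar) // -/I'; ring.
  rewrite normrN; apply: soint_le.
    by apply: bm_add; [apply: bm_add => //|]; exact: bN.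
  by move=> c'; rewrite mulN1r mulNr; apply: hK; rewrite ltW.
apply/eqP; rewrite -normr_le0; apply/ler_addgt0Pr => eps eps0; rewrite add0r.
pose t := Num.min 1 (eps / (`|K| + 1)).
have K1 : 0 < `|K| + 1 by rewrite ltr_wpDl.
have t0 : 0 < t by rewrite lt_min ltr01 divr_gt0.
rewrite (le_trans (small t _)) ?t0 ?ge_min ?lexx //.
rewrite (@le_trans _ _ ((`|K| + 1) * t)) //.
  by rewrite ler_wpM2r ?(ltW t0) // (le_trans (ler_norm K)) // lerDl.
by rewrite -ler_pdivlMl // mulrC ge_min lexx orbT.
Qed.

End Derivation.

(** * Words, cores and contractions *)

Lemma lexlt_total (s t : seq int) : size s = size t -> s != t -> lexlt t s = ~~ lexlt s t.
Proof.
elim: s t => [|x s IH] [|y t] //= [sz]; rewrite eqseq_cons.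
case: (ltgtP x y) => //= _ /IH; exact.
Qed.

Section Edges.
Variable d : nat.
Implicit Types (e f : edge d) (p q l : seq (edge d)).

Lemma ev_einv e : ev (einv e) = eu e.
Proof.
case: e => [[u i] b]; apply/ffunP => k; rewrite !ffunE /= /eu /=.
by case: (k == i) b => [] [] /=; rewrite ?addr0 // ?addrK ?subrK.
Qed.

Lemma einvK : involutive (@einv d).
Proof.
by move=> e; rewrite /einv ev_einv /= negbK; case: e => [[u i] b].
Qed.

Lemma einv_neq e : einv e != e.
Proof. by apply/eqP => /(congr1 snd) /=; case: e.2. Qed.

Lemma eu_neq_ev e : eu e != ev e.
Proof.
apply/eqP => /ffunP/(_ e.1.2); rewrite ffunE eqxx => /eqP.
by rewrite -subr_eq0 opprD addrA subrr sub0r oppr_eq0; case: e.2.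
Qed.

Lemma vlt_total (u v : vertex d) : u != v -> vlt v u = ~~ vlt u v.
Proof.
move=> ne; apply: lexlt_total; first by rewrite !size_map.
apply: contraNneq ne => /eq_in_map uv; apply/eqP/ffunP => i.
by apply: uv; rewrite mem_enum.
Qed.

Lemma positive_einv e : positive (einv e) = ~~ positive e.
Proof. by rewrite /positive ev_einv -vlt_total ?eu_neq_ev. Qed.

Lemma pinv_cons e p : Defs.pinv (e :: p) = Defs.pinv p ++ [:: einv e].
Proof. by rewrite /Defs.pinv /= rev_cons -cats1. Qed.

End Edges.

Section Words.
Variables (R : realType) (N d : nat).
Notation conf := (soconf R N d).
Implicit Types (c : conf) (e f : edge d) (p q l : seq (edge d)).

Definition Qe c e : 'M[R]_N := Qof (matconf c) e.
Definition word c l : 'M[R]_N := foldr (fun e M => Qe c e *m M) 1%:M l.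
Definition wilson c l : R := Wl (matconf c) l.

Lemma wilsonE c l : wilson c l = \tr (word c l).
Proof. by []. Qed.

Lemma Qe_einv c e : Qe c (einv e) = (Qe c e)^T.
Proof.
by rewrite /Qe /Qof positive_einv einvK; case: (positive e); rewrite ?trmxK.
Qed.

Lemma trmx_mul_Qe c e : (Qe c e)^T *m Qe c e = 1%:M.
Proof.
rewrite /Qe /Qof; case: ifP => _; first exact: SO_trmx_mul.
by rewrite trmxK; exact: SO_mul_trmx.
Qed.

Lemma mul_Qe_trmx c e : Qe c e *m (Qe c e)^T = 1%:M.
Proof. exact: mulmx1C (trmx_mul_Qe c e). Qed.

Lemma word_cons c e l : word c (e :: l) = Qe c e *m word c l.
Proof. by []. Qed.

Lemma word_nil c : word c [::] = 1%:M.
Proof. by []. Qed.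

Lemma word_cat c p q : word c (p ++ q) = word c p *m word c q.
Proof. by elim: p => /= [|e p ->]; rewrite ?mul1mx ?mulmxA. Qed.

Lemma word_pinv c p : word c (Defs.pinv p) = (word c p)^T.
Proof.
elim: p => [|e p IH]; first by rewrite trmx1.
by rewrite pinv_cons word_cat IH /= mulmx1 Qe_einv trmx_mul.
Qed.

Lemma word_erase_lin c p q : erase_lin p = Some q -> word c q = word c p.
Proof.
elim: p q => //= e1 [|e2 p] // IH q; case: ifP => [/eqP-> [<-]|_].
  by rewrite !word_cons Qe_einv mulmxA mul_Qe_trmx mul1mx.
by case: (erase_lin (e2 :: p)) IH => //= r /(_ r erefl) h [<-] /=; rewrite h.
Qed.

Lemma wilson_erase1 c p q : erase1 p = Some q -> wilson c q = wilson c p.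
Proof.
rewrite /erase1 !wilsonE; case E: (erase_lin p) => [r|].
  by move=> [<-]; rewrite (word_erase_lin c E).
case: p E => // e p _; case: ifP => // /eqP h [<-].
(* No edge is its own inverse, so a cyclic backtrack involves two distinct letters; cyclicity of the
   trace brings them together. *)
case/lastP: p h => [/esym/eqP|p f]; first by rewrite (negPf (einv_neq _)).
rewrite last_rcons => ef; rewrite belast_rcons /= -cats1 word_cat /= mulmx1 ef Qe_einv.
by rewrite mulmxA mxtrace_mulC mulmxA mul_Qe_trmx mul1mx.
Qed.

(** Each erasure cancels a product [Q Q^T], up to cyclicity of the trace for a backtrack at the end,
    so iterating erasures changes nothing. *)
Lemma wilson_core c p : wilson c (core p) = wilson c p.
Proof.
rewrite /core; elim: (size p) => //= n <-.
by case E: (erase1 _) => [q|] //=; exact: wilson_erase1 E.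
Qed.

End Words.

Section Contractions.
Variables (R : realType) (N : nat).
Implicit Types (M P Q : 'M[R]_N).

Lemma delta_mul_entry (i j k l : 'I_N) M :
  (delta_mx i j *m M) k l = (k == i)%:R * M j l.
Proof.
rewrite mxE (bigD1 j) //= big1 => [|m mj]; rewrite mxE ?eqxx ?andbT ?addr0 //.
by rewrite (negPf mj) andbF mul0r.
Qed.

Lemma mxtrace_delta_mul (i j : 'I_N) M : \tr (delta_mx i j *m M) = M j i.
Proof.
rewrite /mxtrace (bigD1 i) //= big1 => [|k ki]; rewrite delta_mul_entry.
  by rewrite eqxx mul1r addr0.
by rewrite (negPf ki) mul0r.
Qed.

Lemma mxtrace_delta_delta (i j k l : 'I_N) M P :
  \tr (delta_mx i j *m M *m (delta_mx k l *m P)) = M j k * P l i.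
Proof.
rewrite -mulmxA mxtrace_delta_mul mxE (bigD1 k) //= big1 => [|m mk].
  by rewrite delta_mul_entry eqxx mul1r addr0.
by rewrite delta_mul_entry (negPf mk) mul0r mulr0.
Qed.

Notation X := (skew_delta R).

Lemma mxtrace_trmx_mul M P : \tr (M^T *m P) = \sum_i \sum_j M i j * P i j.
Proof.
rewrite /mxtrace exchange_big; apply: eq_bigr => i _; rewrite mxE.
by apply: eq_bigr => j _; rewrite mxE.
Qed.

Lemma mxtrace_mul M P : \tr (M *m P) = \sum_i \sum_j M i j * P j i.
Proof. by apply: eq_bigr => i _; rewrite mxE. Qed.

(** Two letters of one loop: [\tr (M^T *m P)] reverses one of the two arcs and is the source of the
    twistings, while the product of traces is the source of the splittings. *)
Lemma skew_contract_joined M P :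
  \sum_i \sum_j \tr (X i j *m M *m (X i j *m P)) =
  2 * (\tr (M^T *m P) - \tr M * \tr P).
Proof.
have E i j : \tr (X i j *m M *m (X i j *m P)) =
    M j i * P j i + M i j * P i j - (M j j * P i i + M i i * P j j).
  rewrite /skew_delta !(mulmxBl, mulmxBr) !linearB /= !mxtrace_delta_delta; ring.
rewrite (eq_bigr _ (fun i _ => eq_bigr _ (fun j _ => E i j))).
rewrite (eq_bigr _ (fun i _ => sumrB _ _ _ _)) sumrB.
rewrite !(eq_bigr _ (fun i _ => big_split _ _ _ _ _)) /= !big_split /=.
rewrite [\sum_i \sum_j M j i * _]exchange_big /= -mxtrace_trmx_mul.
rewrite [\sum_i \sum_j M j j * _]exchange_big /=.
have -> : \sum_i \sum_j M i i * P j j = \tr M * \tr P.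
  by rewrite mulr_suml; apply: eq_bigr => i _; rewrite mulr_sumr.
ring.
Qed.

(** Letters of two different loops: both contracted terms are single traces, the two loops being
    joined with or without a reversal. *)
Lemma skew_contract_split M P :
  \sum_i \sum_j \tr (X i j *m M) * \tr (X i j *m P) =
  2 * (\tr (M^T *m P) - \tr (M *m P)).
Proof.
have E i j : \tr (X i j *m M) * \tr (X i j *m P) =
    M j i * P j i + M i j * P i j - (M j i * P i j + M i j * P j i).
  rewrite /skew_delta !(mulmxBl, mulmxBr) !linearB /= !mxtrace_delta_mul; ring.
rewrite (eq_bigr _ (fun i _ => eq_bigr _ (fun j _ => E i j))).
rewrite (eq_bigr _ (fun i _ => sumrB _ _ _ _)) sumrB.
rewrite !(eq_bigr _ (fun i _ => big_split _ _ _ _ _)) /= !big_split /=.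
rewrite [\sum_i \sum_j M j i * P j i]exchange_big /= -mxtrace_trmx_mul.
rewrite [\sum_i \sum_j M j i * P i j]exchange_big /= -mxtrace_mul.
ring.
Qed.

End Contractions.

Section LetterVariation.
Variables (R : realType) (N d : nat).
Notation conf := (soconf R N d).
Notation skew := (skew_delta R).
Implicit Types (c : conf) (e f : edge d) (P B C : 'M[R]_N) (l : seq (edge d)).

(** Variation of [Q_f] when [Q_e0] becomes [(1 + t X) Q_e0]. On the inverse edge the transpose puts
    [X] on the right, with a minus sign because [X] is skew. [ddQe] below is the variation of [dQe]
    itself. *)
Definition dQe e0 (X : 'M[R]_N) c f : 'M[R]_N :=
  if f == e0 then X *m Qe c f
  else if f == einv e0 then - (Qe c f *m X) else 0.

Definition ddQe e0 (X : 'M[R]_N) c f : 'M[R]_N :=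
  if f == e0 then X *m (X *m Qe c f)
  else if f == einv e0 then Qe c f *m X *m X else 0.

Lemma dQe_unrelated e0 X c e f : e = e0 \/ e = einv e0 ->
  ~~ related e f -> dQe e0 X c f = 0.
Proof.
rewrite /related /dQe negb_or => -[]-> /andP[/negPf h1 /negPf h2].
  by rewrite h1 h2.
by rewrite einvK in h2; rewrite h1 h2.
Qed.

Lemma sum2_eq (F G : 'I_N -> 'I_N -> R) : (forall i j, F i j = G i j) ->
  \sum_i \sum_j F i j = \sum_i \sum_j G i j.
Proof. by move=> FG; apply: eq_bigr => i _; apply: eq_bigr => j _. Qed.

Lemma sum2N (F : 'I_N -> 'I_N -> R) :
  \sum_i \sum_j - F i j = - \sum_i \sum_j F i j.
Proof. by rewrite -sumrN; apply: eq_bigr => i _; rewrite sumrN. Qed.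

Section Fixed.
Variables (e0 : edge d) (c : conf) (e : edge d).
Hypothesis ee0 : e = e0 \/ e = einv e0.
Let Q := Qe c e.
Let QtQ : Q^T *m Q = 1%:M. Proof. exact: trmx_mul_Qe. Qed.

Let einv_eqF (f : edge d) : (einv f == f) = false.
Proof. by apply/negbTE; apply: einv_neq. Qed.

(** Both [X] are adjacent, so this is [skew_contract_joined] with first matrix 1:
    [2 (\tr M - N \tr M)]. *)
Lemma contract_diag P :
  \sum_i \sum_j \tr (ddQe e0 (skew i j) c e *m P) =
  - (2 * (N%:R - 1) * \tr (Q *m P)).
Proof.
have K (M : 'M[R]_N) : \sum_i \sum_j \tr (skew i j *m 1%:M *m (skew i j *m M)) =
    - (2 * (N%:R - 1) * \tr M).
  have tr1 : \tr (1%:M : 'M[R]_N) = N%:R by exact: mxtrace1.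
  by rewrite skew_contract_joined trmx1 mul1mx tr1; ring.
rewrite /ddQe /Q; case: ee0 => ->; rewrite ?eqxx ?einv_eqF.
  by rewrite -K; apply: sum2_eq => i j; rewrite mulmx1 !mulmxA.
rewrite mxtrace_mulC -K; apply: sum2_eq => i j.
by rewrite mulmx1 -!mulmxA mxtrace_mulC -!mulmxA.
Qed.

(** The contracted matrices are [Q B], [Q C] if [e = e0], and [B Q], [C Q] if [e] is the inverse,
    where [X] stands on the right. In both cases orthogonality removes [Q] from the reversed term,
    so the result does not depend on the orientation of [e]. *)
Lemma contract_split_same B C :
  \sum_i \sum_j \tr (dQe e0 (skew i j) c e *m B *m (dQe e0 (skew i j) c e *m C)) =
  2 * (\tr (B^T *m C) - \tr (Q *m C) * \tr (B *m Q)).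
Proof.
rewrite [_ * \tr (B *m Q)]mulrC.
case: ee0 => eE.
  transitivity (\sum_i \sum_j \tr (skew i j *m (Q *m B) *m (skew i j *m (Q *m C)))).
    by apply: sum2_eq => i j; rewrite /dQe eE eqxx -eE -/Q !mulmxA.
  rewrite skew_contract_joined trmx_mul -mulmxA (mulmxA Q^T) QtQ mul1mx.
  by rewrite (mxtrace_mulC Q B).
transitivity (\sum_i \sum_j \tr (skew i j *m (B *m Q) *m (skew i j *m (C *m Q)))).
  apply: sum2_eq => i j; rewrite /dQe eE einv_eqF eqxx -eE -/Q.
  rewrite !mulNmx mulmxN opprK -!mulmxA mxtrace_mulC; congr (\tr _).
  by rewrite !mulmxA.
rewrite skew_contract_joined trmx_mul mulmxA mxtrace_mulC !mulmxA.
by rewrite (mulmx1C QtQ) mul1mx (mxtrace_mulC C Q).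
Qed.

(** Exactly one of the two opposite letters carries the minus sign of [dQe], which is why the
    splitting now has a plus sign and the twisting a minus sign. *)
Lemma contract_split_inv B C :
  \sum_i \sum_j \tr (dQe e0 (skew i j) c e *m B *m (dQe e0 (skew i j) c (einv e) *m C)) =
  2 * (\tr C * \tr B - \tr (Q *m (B^T *m (Q^T *m C)))).
Proof.
have dE X : dQe e0 X c (einv e) = if e == e0 then - (Q^T *m X) else X *m Q^T.
  rewrite /dQe Qe_einv -/Q; case: ee0 => ->; first by rewrite einv_eqF !eqxx.
  by rewrite einvK eqxx einv_eqF.
case: ee0 => eE.
  transitivity (\sum_i \sum_j - \tr (skew i j *m (Q *m B *m Q^T) *m (skew i j *m C))).
    apply: sum2_eq => i j; rewrite dE /dQe eE eqxx -eE -/Q.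
    by rewrite mulNmx mulmxN linearN /= !mulmxA.
  rewrite sum2N skew_contract_joined (mxtrace_mulC (Q *m B)) !mulmxA QtQ mul1mx.
  by rewrite !trmx_mul trmxK !mulmxA; ring.
transitivity (\sum_i \sum_j - \tr (skew i j *m B *m (skew i j *m (Q^T *m C *m Q)))).
  apply: sum2_eq => i j; rewrite dE /dQe eE einv_eqF eqxx -eE -/Q.
  rewrite !mulNmx linearN /= -!mulmxA mxtrace_mulC; congr (- \tr _).
  by rewrite !mulmxA.
rewrite sum2N skew_contract_joined (mxtrace_mulC (Q^T *m C)) !mulmxA (mulmx1C QtQ) mul1mx.
rewrite (mxtrace_mulC _ Q) !mulmxA; ring.
Qed.

(** [B] and [C] are the words of the two loops opened at the common edge: [C^T B] spells the
    negative merger and [Q C Q B] the positive one. *)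
Lemma contract_merge_same B C :
  \sum_i \sum_j \tr (dQe e0 (skew i j) c e *m B) * \tr (dQe e0 (skew i j) c e *m C) =
  2 * (\tr (C^T *m B) - \tr (Q *m (C *m (Q *m B)))).
Proof.
have sw : \tr (C^T *m B) = \tr (B^T *m C) by rewrite -mxtrace_tr trmx_mul trmxK.
rewrite sw; case: ee0 => eE.
  transitivity (\sum_i \sum_j \tr (skew i j *m (Q *m B)) * \tr (skew i j *m (Q *m C))).
    by apply: sum2_eq => i j; rewrite /dQe eE eqxx -eE -/Q !mulmxA.
  rewrite skew_contract_split trmx_mul -(mulmxA B^T) (mulmxA Q^T) QtQ mul1mx.
  by rewrite (mxtrace_mulC (Q *m B)) !mulmxA.
transitivity (\sum_i \sum_j \tr (skew i j *m (B *m Q)) * \tr (skew i j *m (C *m Q))).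
  apply: sum2_eq => i j; rewrite /dQe eE einv_eqF eqxx -eE -/Q.
  rewrite !mulNmx !linearN /= mulrNN.
  by rewrite -!(mulmxA Q) !(mxtrace_mulC Q) !mulmxA.
have h1 : \tr ((B *m Q)^T *m (C *m Q)) = \tr (B^T *m C).
  by rewrite trmx_mul mulmxA mxtrace_mulC !mulmxA (mulmx1C QtQ) mul1mx.
have h2 : \tr (B *m Q *m (C *m Q)) = \tr (Q *m (C *m (Q *m B))).
  by rewrite -mulmxA mxtrace_mulC !mulmxA.
by rewrite skew_contract_split h1 h2.
Qed.

(** As before with the second loop traversed backwards: [C] and [C^T] exchange their places. *)
Lemma contract_merge_inv B C :
  \sum_i \sum_j \tr (dQe e0 (skew i j) c e *m B) * \tr (dQe e0 (skew i j) c (einv e) *m C) =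
  2 * (\tr (C *m B) - \tr (Q *m (C^T *m (Q *m B)))).
Proof.
have dE X : dQe e0 X c (einv e) = if e == e0 then - (Q^T *m X) else X *m Q^T.
  rewrite /dQe Qe_einv -/Q; case: ee0 => ->; first by rewrite einv_eqF !eqxx.
  by rewrite einvK eqxx einv_eqF.
case: ee0 => eE.
  transitivity (\sum_i \sum_j - (\tr (skew i j *m (C *m Q^T)) * \tr (skew i j *m (Q *m B)))).
    apply: sum2_eq => i j; rewrite dE /dQe eE eqxx -eE -/Q.
    rewrite mulNmx linearN /= mulrN mulrC; congr (- (_ * _)); last by rewrite !mulmxA.
    by rewrite -mulmxA mxtrace_mulC !mulmxA.
  rewrite sum2N skew_contract_split -mulmxA (mulmxA Q^T) QtQ mul1mx.
  by rewrite trmx_mul trmxK !mulmxA; ring.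
transitivity (\sum_i \sum_j - (\tr (skew i j *m (Q^T *m C)) * \tr (skew i j *m (B *m Q)))).
  apply: sum2_eq => i j; rewrite dE /dQe eE einv_eqF eqxx -eE -/Q.
  rewrite mulNmx linearN /= mulNr mulrC; congr (- (_ * _)); first by rewrite !mulmxA.
  by rewrite -mulmxA mxtrace_mulC !mulmxA.
have h1 : \tr ((Q^T *m C)^T *m (B *m Q)) = \tr (Q *m (C^T *m (Q *m B))).
  by rewrite trmx_mul trmxK mulmxA mxtrace_mulC !mulmxA.
have h2 : \tr (Q^T *m C *m (B *m Q)) = \tr (C *m B).
  by rewrite mulmxA mxtrace_mulC !mulmxA (mulmx1C QtQ) mul1mx.
by rewrite sum2N skew_contract_split h1 h2; ring.
Qed.

End Fixed.
End LetterVariation.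

(** * Derivatives of Wilson loops *)

Lemma locE (d : nat) (l : seq (edge d)) : loc l =
  if l is f :: l' then (0%N, f) :: [seq (p.1.+1, p.2) | p <- loc l'] else [::].
Proof.
case: l => // f l; rewrite /loc /=; congr (_ :: _).
by elim: l 0%N => //= h l IH n; rewrite -IH.
Qed.

Lemma big_loc_cat (d : nat) (V : zmodType) (p q : seq (edge d)) (F : nat -> edge d -> V) :
  \sum_(y <- loc (p ++ q)) F y.1 y.2 =
  \sum_(y <- loc p) F y.1 y.2 + \sum_(y <- loc q) F (size p + y.1)%N y.2.
Proof.
elim: p F => [|f p IH] F /=; first by rewrite [loc [::]]locE big_nil add0r.
rewrite [loc (f :: _)]locE [loc (f :: p)]locE !big_cons !big_map /=.
by rewrite (IH (fun n => F n.+1)) addrA.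
Qed.

Section WordDerivatives.
Variables (R : realType) (N d : nat).
Variables (e0 : edge d) (X : 'M[R]_N) (g : R -> SO R N) (Kg : R).
Hypothesis e0_pos : positive e0.
Hypothesis XT : X^T = - X.
Hypothesis gX : forall t k l, 0 <= t <= 1 ->
  `|soval (g t) k l - (1%:M k l + t * X k l)| <= Kg * t ^+ 2.
Notation conf := (soconf R N d).
Notation isder := (isder e0 g).

Definition isder_mx (A A' : conf -> 'M[R]_N) : Prop :=
  forall k l, isder (fun c => A c k l) (fun c => A' c k l).

Lemma eq_isder_mx A A' B B' : A =1 B -> A' =1 B' -> isder_mx A A' -> isder_mx B B'.
Proof. by move=> /funext-> /funext->. Qed.

Lemma isder_mx_cst A : isder_mx (fun=> A) (fun=> 0).
Proof.
by move=> k l; apply: eq_isder (isder_cst _ _ (A k l)) => // c; rewrite mxE.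
Qed.

Lemma isder_opp F F' : isder F F' -> isder (fun c => - F c) (fun c => - F' c).
Proof.
move=> h; apply: eq_isder (isder_mul (isder_cst e0 g (-1)) h) => c.
  by rewrite mulN1r.
by rewrite mul0r add0r mulN1r.
Qed.

Lemma isder_mx_opp A A' : isder_mx A A' -> isder_mx (fun c => - A c) (fun c => - A' c).
Proof.
by move=> h k l; apply: eq_isder (isder_opp (h k l)) => c; rewrite mxE.
Qed.

Lemma isder_mx_tr A A' : isder_mx A A' -> isder_mx (fun c => (A c)^T) (fun c => (A' c)^T).
Proof. by move=> h k l; apply: eq_isder (h l k) => c; rewrite mxE. Qed.

Lemma isder_mx_mul A A' B B' : isder_mx A A' -> isder_mx B B' ->
  isder_mx (fun c => A c *m B c) (fun c => A' c *m B c + A c *m B' c).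
Proof.
move=> hA hB k l.
have := isder_sum (enum 'I_N) (fun m => isder_mul (hA k m) (hB m l)).
by apply: eq_isder => c; rewrite big_enum !mxE // big_split.
Qed.

Lemma isder_mxtrace A A' : isder_mx A A' ->
  isder (fun c => \tr (A c)) (fun c => \tr (A' c)).
Proof.
move=> hA; have := isder_sum (enum 'I_N) (fun m => hA m m).
by apply: eq_isder => c; rewrite big_enum.
Qed.

(** Only positive edges are variables of a configuration; a negative edge is handled by transposing
    the result for its inverse. *)
Lemma isder_Qe f : isder_mx (fun c => Qe c f) (fun c => dQe e0 X c f).
Proof.
have main f' : positive f' -> isder_mx (fun c => Qe c f') (fun c => dQe e0 X c f').
  move=> pf k l; have Qf c : Qe c f' = soval (c f') by rewrite /Qe /Qof pf.
  have nf : (f' == einv e0) = false.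
    by apply/negbTE; apply: contraTneq pf => ->; rewrite positive_einv e0_pos.
  have [fe|fe] := eqVneq f' e0.
    apply: eq_isder (isder_moved e0 gX k l) => c.
      by rewrite Qf fe.
    by rewrite /dQe fe eqxx -fe Qf.
  apply: eq_isder (isder_unmoved g k l fe) => c; first by rewrite Qf.
  by rewrite /dQe (negPf fe) nf mxE.
have [|nf] := boolP (positive f); first exact: main.
have pf : positive (einv f) by rewrite positive_einv.
apply: eq_isder_mx (isder_mx_tr (main _ pf)) => c; first by rewrite -Qe_einv einvK.
rewrite /dQe (inv_eq (@einvK d)) (can_eq (@einvK d)).
have -> : (f == e0) = false by apply: contraNF nf => /eqP->.
case: (eqVneq f (einv e0)) => [->|_]; last by rewrite trmx0.
by rewrite einvK trmx_mul XT mulmxN Qe_einv.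
Qed.

Lemma isder_dQe f : isder_mx (fun c => dQe e0 X c f) (fun c => ddQe e0 X c f).
Proof.
have XQ := isder_mx_mul (isder_mx_cst X) (isder_Qe f).
have QX := isder_mx_opp (isder_mx_mul (isder_Qe f) (isder_mx_cst X)).
have einv_e0 : (einv e0 == e0) = false by apply/negbTE; apply: einv_neq.
rewrite /dQe /ddQe; case: (eqVneq f e0) => [->|fe] in XQ QX *.
  by apply: eq_isder_mx XQ => c; rewrite // /dQe eqxx mul0mx add0r.
case: (eqVneq f (einv e0)) => [->|fe'] in XQ QX *; last exact: isder_mx_cst.
apply: eq_isder_mx QX => c //.
by rewrite /dQe einv_e0 eqxx mulmx0 addr0 mulNmx opprK.
Qed.

Definition dword c l : 'M[R]_N :=
  \sum_(p <- loc l) word c (take p.1 l) *m (dQe e0 X c p.2 *m word c (drop p.1.+1 l)).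

Lemma dword_cons c f l : dword c (f :: l) = dQe e0 X c f *m word c l + Qe c f *m dword c l.
Proof.
rewrite /dword [loc (f :: l)]locE big_cons big_map /= mul1mx drop0; congr (_ + _).
by rewrite mulmx_sumr; apply: eq_bigr => p _; rewrite !mulmxA.
Qed.

Lemma isder_word l : isder_mx (fun c => word c l) (fun c => dword c l).
Proof.
elim: l => [|f l IH].
  by apply: eq_isder_mx (isder_mx_cst 1%:M) => // c; rewrite /dword big_nil.
apply: eq_isder_mx (isder_mx_mul (isder_Qe f) IH) => // c.
by rewrite dword_cons.
Qed.

(** The Leibniz term of [W_l] for the letter [f] at [y], with the loop rotated to start there. *)
Definition cut_loop c l y f : R :=
  \tr (dQe e0 X c f *m word c (drop y.+1 l ++ take y l)).

Lemma isder_wilson l : isder (fun c => wilson c l)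
  (fun c => \sum_(p <- loc l) cut_loop c l p.1 p.2).
Proof.
apply: eq_isder (isder_mxtrace (isder_word l)) => // c.
rewrite /dword linear_sum /=; apply: eq_bigr => p _.
by rewrite mxtrace_mulC /cut_loop word_cat !mulmxA.
Qed.

Lemma isder_cut_loop e m : isder (fun c => \tr (dQe e0 X c e *m word c m))
  (fun c => \tr (ddQe e0 X c e *m word c m) +
     \sum_(p <- loc m) \tr (dQe e0 X c e *m word c (take p.1 m) *m
        (dQe e0 X c p.2 *m word c (drop p.1.+1 m)))).
Proof.
apply: eq_isder (isder_mxtrace (isder_mx_mul (isder_dQe e) (isder_word m))) => // c.
rewrite linearD /= /dword mulmx_sumr linear_sum /=; congr (_ + _).
by apply: eq_bigr => p _; rewrite !mulmxA.
Qed.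

End WordDerivatives.

(* Cyclically, [l = e m]; location [y <> size a] of [l] corresponds to location
   [rel_pos l (size a) y - 1] of [m]. *)
Lemma big_loc_rot (d : nat) (V : zmodType) (a b : seq (edge d)) (e : edge d)
    (F : seq (edge d) -> edge d -> seq (edge d) -> V)
    (l := a ++ e :: b) (m := b ++ a) :
  \sum_(p <- loc m) F (take p.1 m) p.2 (drop p.1.+1 m) =
  \sum_(p <- loc l | size a != p.1) F (part_b l (size a) p.1) p.2 (part_c l (size a) p.1).
Proof.
have rotl : rot (size a) l = e :: m by rewrite /rot /l drop_size_cat // take_size_cat.
have szl : size l = (size a + (size b).+1)%N by rewrite size_cat.
have loc_lt (q : seq (edge d)) p : p \in loc q -> (p.1 < size q)%N.
  case: p => n h /= /(map_f fst); rewrite -/(unzip1 _) unzip1_zip ?size_iota //.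
  by rewrite mem_iota add0n.
rewrite (big_loc_cat b a (fun n f => F (take n m) f (drop n.+1 m))).
rewrite [RHS]big_mkcond /= [RHS](big_loc_cat a (e :: b) (fun n f => if size a != n then
   F (part_b l (size a) n) f (part_c l (size a) n) else 0)).
rewrite [loc (e :: b)]locE big_cons big_map /= addn0 eqxx add0r addrC.
congr (_ + _); apply: eq_big_seq => p /loc_lt pl.
  have r : rel_pos l (size a) p.1 = (size b + p.1).+1.
    rewrite /rel_pos szl modn_small; lia.
  rewrite ifT; last by rewrite eq_sym neq_ltn pl.
  by rewrite /part_b /part_c r rotl /=.
have r : rel_pos l (size a) (size a + p.1.+1) = p.1.+1.
  rewrite /rel_pos szl (_ : (_ - _)%N = p.1.+1 + (size a + (size b).+1)) ?modnDr; last lia.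
  by rewrite modn_small; lia.
rewrite ifT; last lia.
by rewrite /part_b /part_c r rotl /=.
Qed.

(** * Lattice geometry *)

Section Plaquettes.
Variable d : nat.
Implicit Types (e f : edge d) (l p : seq (edge d)) (V : seq (vertex d)) (u v w : vertex d).

Lemma mem_nbhd_ev e : ev e \in nbhd (eu e).
Proof.
case: e => [[u i] b]; rewrite /nbhd inE; apply/orP; right.
by apply/allpairsP; exists (i, b); rewrite mem_enum; case: b.
Qed.

Lemma mem_nbhd_eu e : eu e \in nbhd (ev e).
Proof. by rewrite -ev_einv mem_nbhd_ev. Qed.

Lemma mem_nbhd w : w \in nbhd w.
Proof. by rewrite inE eqxx. Qed.

Lemma nbhd_within1 u w : w \in nbhd u -> within1 u w.
Proof.
rewrite inE => /orP[/eqP->|].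
  by rewrite /within1 big1 // => i _; rewrite subrr normr0.
move=> /allpairsP[[i b] /= [_ _ ->]].
rewrite /within1 (bigD1 i) //= big1 => [|k ki]; rewrite ffunE ?(negPf ki) ?addr0 ?subrr ?normr0 //.
by rewrite eqxx opprD addrA subrr sub0r normrN; case: b.
Qed.

(** Every end of an edge of a loop is also a start of one, so a hypothesis on starting vertices
    controls both ends. *)
Lemma closed_next l e : Defs.closed l -> e \in l -> exists2 f, f \in l & eu f = ev e.
Proof.
move=> /andP[ch cl]; case: l ch cl => // f l ch /eqP cl.
have : e \in f :: l -> e = last f l \/ exists2 h, h \in l & eu h = ev e.
  elim: l f ch {cl} => [|h l IH] f /= => [_|/andP[/eqP fh ch]].
    by rewrite inE => /eqP; left.
  rewrite inE => /orP[/eqP->|/(IH _ ch)[->|[k kl ek]]]; [|by left|].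
    by right; exists h; rewrite ?inE ?eqxx.
  by right; exists k; rewrite // inE kl orbT.
move=> + el => /(_ el)[->|[h hl eh]]; first by exists f; rewrite ?inE ?eqxx.
by exists h; rewrite // inE hl orbT.
Qed.

Lemma uniq_flatten_map (S T : eqType) (F : S -> seq T) (r : seq S) :
  uniq r -> (forall x, uniq (F x)) ->
  (forall x y z, z \in F x -> z \in F y -> x = y) -> uniq (flatten [seq F x | x <- r]).
Proof.
move=> + uF Fxy; elim: r => //= x r IH /andP[xr /IH ur].
rewrite cat_uniq uF ur andbT; apply/hasPn => z /flatten_mapP[y yr zy].
by apply: contra xr => zx; rewrite (Fxy _ _ _ zx zy).
Qed.

Lemma mem_edges_in V e : (e \in edges_in V) = (eu e \in V) && (ev e \in V).
Proof.
rewrite mem_filter andbC; congr (_ && _); apply/flatten_mapP/idP => [[w wV /mapP[ib _ ->]] //|eV].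
exists (eu e) => //; apply/mapP; exists (e.1.2, e.2); last by case: e {eV} => [[]].
by apply/allpairsP; exists (e.1.2, e.2); rewrite mem_enum; case: e.2.
Qed.

Lemma uniq_edges_in V : uniq V -> uniq (edges_in V).
Proof.
move=> uV; apply/filter_uniq/uniq_flatten_map => // [w|w w' e /mapP[? _ ->] /mapP[? _ [->]] //].
rewrite map_inj_uniq => [|[i b] [j b'] [-> ->]] //.
by apply: allpairs_uniq => //; [exact: enum_uniq|case=> ? ? []].
Qed.

Lemma mem_paths4 (E : seq (edge d)) p : p \in paths4 E = (size p == 4%N) && all (mem E) p.
Proof.
apply/flatten_mapP/idP => [[e1 h1 /flatten_mapP[e2 h2 /flatten_mapP[e3 h3 /mapP[e4 h4 ->]]]]|].
  by rewrite /= h1 h2 h3 h4.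
case: p => [|e1 [|e2 [|e3 [|e4 [|]]]]] //= /and5P[h1 h2 h3 h4 _].
exists e1 => //; apply/flatten_mapP; exists e2 => //.
by apply/flatten_mapP; exists e3 => //; apply/mapP; exists e4.
Qed.

Lemma uniq_paths4 (E : seq (edge d)) : uniq E -> uniq (paths4 E).
Proof.
move=> uE; apply: uniq_flatten_map => // [e1|e1 e1' p]; last first.
  by move=> /flatten_mapP[? _ /flatten_mapP[? _ /mapP[? _ ->]]]
            /flatten_mapP[? _ /flatten_mapP[? _ /mapP[? _ []]]].
apply: uniq_flatten_map => // [e2|e2 e2' p]; last first.
  by move=> /flatten_mapP[? _ /mapP[? _ ->]] /flatten_mapP[? _ /mapP[? _ []]].
apply: uniq_flatten_map => // [e3|e3 e3' p /mapP[? _ ->] /mapP[? _ []] //].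
by rewrite map_inj_uniq // => ? ? [].
Qed.

Lemma mem_Pplus_in V p : (p \in Pplus_in V) =
  [&& is_plaquette p, pplus_cond p & all (fun e => (eu e \in V) && (ev e \in V)) p].
Proof.
rewrite mem_filter mem_paths4 -andbA; case: (boolP (is_plaquette p)) => //= /andP[-> _].
by congr (_ && _); apply: eq_all => e; exact: mem_edges_in.
Qed.

Lemma uniq_Pplus_in V : uniq V -> uniq (Pplus_in V).
Proof. by move=> uV; apply/filter_uniq/uniq_paths4/uniq_edges_in. Qed.

(** On a closed path of length 4, each vertex is an end of [e] or adjacent to one. Reversing [e]
    only exchanges its ends, so [e] itself may be assumed to lie on [p]. *)
Lemma plaquette_nbhd p e : is_plaquette p -> (e \in p) || (einv e \in p) ->
  all (fun f => (eu f \in nbhd (eu e) ++ nbhd (ev e)) && (ev f \in nbhd (eu e) ++ nbhd (ev e))) p.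
Proof.
move=> /andP[sz /and3P[/andP[ch cl] _ _]].
wlog ep : e / e \in p => [wl|_].
  move=> /orP[ep|ep]; first by apply: wl => //; rewrite ep.
  have := wl _ ep; rewrite ep => /(_ isT); apply: sub_all => f.
  by rewrite ev_einv (_ : eu (einv e) = ev e) // !mem_cat orbC (orbC (ev f \in _)).
have inS w := mem_cat w (nbhd (eu e)) (nbhd (ev e)).
set S := nbhd (eu e) ++ nbhd (ev e) in inS *.
case: p sz ch cl ep => [|e1 [|e2 [|e3 [|e4 [|]]]]] //= _ /and4P[/eqP h1 /eqP h2 /eqP h3 _] /eqP h4.
have n w : w \in nbhd w by exact: mem_nbhd.
have a1 := mem_nbhd_ev e1; have a2 := mem_nbhd_ev e2.
have a3 := mem_nbhd_ev e3; have a4 := mem_nbhd_ev e4.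
have b1 := mem_nbhd_eu e1; have b2 := mem_nbhd_eu e2.
have b3 := mem_nbhd_eu e3; have b4 := mem_nbhd_eu e4.
rewrite h1 h2 h3 h4 in a1 a2 a3 a4 b1 b2 b3 b4 *.
move=> ep; have : [|| e == e1, e == e2, e == e3 | e == e4] by move: ep; rewrite !inE.
by case/or4P => /eqP ee; rewrite !inS ee ?h1 ?h2 ?h3 ?h4 ?n ?a1 ?a2 ?a3 ?a4 ?b1 ?b2 ?b3 ?b4 ?orbT.

Qed.

(** The passage from the plaquettes of the Gibbs weight to those through [e]. As [V] contains the
    neighbourhoods of both ends of [e], the two duplicate-free lists of plaquettes through [e] have
    the same members. *)
Lemma big_Pplus_at (A : zmodType) V e (F : seq (edge d) -> A) : uniq V ->
  {subset nbhd (eu e) ++ nbhd (ev e) <= V} ->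
  (forall p, ~~ ((e \in p) || (einv e \in p)) -> F p = 0) ->
  \sum_(p <- Pplus_in V) F p = \sum_(p <- Pplus_at e) F p.
Proof.
move=> uV sub F0.
rewrite (bigID (fun p => (e \in p) || (einv e \in p))) /= [X in _ + X]big1 ?addr0 => [|p /F0] //.
rewrite -big_filter; apply: perm_big; apply: uniq_perm.
- by rewrite filter_uniq ?uniq_Pplus_in.
- by rewrite filter_uniq ?uniq_Pplus_in ?undup_uniq.
move=> p; rewrite mem_filter mem_Pplus_in /Pplus_at mem_filter mem_Pplus_in.
case: (boolP ((e \in p) || (einv e \in p))) => // ep; rewrite !andTb.
case: (boolP (is_plaquette p)) => // pp; rewrite !andTb; congr (_ && _).
have pn := plaquette_nbhd pp ep.
transitivity true; last symmetry; apply: sub_all pn => f /andP[h1 h2]; apply/andP.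
  by rewrite !sub.
by rewrite !mem_undup.
Qed.

End Plaquettes.

(** * Operations on loop sequences *)

Lemma mem_enumerate (T : eqType) (s : seq T) p : p \in zip (iota 0 (size s)) s ->
  (p.1 < size s)%N /\ s = take p.1 s ++ p.2 :: drop p.1.+1 s.
Proof.
case: p => k x /(nthP (0%N, x)) [i]; rewrite size_zip size_iota minnn => si.
rewrite nth_zip ?size_iota // nth_iota // add0n => -[<- <-] /=.
by split => //; rewrite -drop_nth // cat_take_drop.
Qed.

Lemma uniq_enumerate (T : eqType) (s : seq T) : uniq (zip (iota 0 (size s)) s).
Proof.
apply: (@map_uniq _ _ fst); rewrite -/(unzip1 _) unzip1_zip ?size_iota //.
exact: iota_uniq.
Qed.

Lemma enumerate_eq_fst (T : eqType) (s : seq T) p q :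
  p \in zip (iota 0 (size s)) s -> q \in zip (iota 0 (size s)) s ->
  (p == q) = (p.1 == q.1).
Proof.
case: p q => [i x] [j y] /mem_enumerate[/= li hi] /mem_enumerate[/= lj hj].
rewrite xpair_eqE; case: eqP => //= ij; subst j.
move: hj; rewrite {1}hi => /eqP; rewrite eqseq_cat // eqxx /= eqseq_cons.
by case/andP.
Qed.

Lemma enumerate_remove (T : Type) (a b : seq T) (x : T) (s := a ++ x :: b) :
  [seq p.2 | p <- zip (iota 0 (size s)) s & p.1 != size a] = a ++ b.
Proof.
rewrite /s size_cat iotaD zip_cat ?size_iota // filter_cat map_cat /= eqxx /=.
have P m (q : seq T) : (forall i, i \in iota m (size q) -> i != size a) ->
    [seq p.2 | p <- zip (iota m (size q)) q & p.1 != size a] = q.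
  move=> h; rewrite (_ : [seq _ <- _ | _] = zip (iota m (size q)) q).
    by rewrite -/(unzip2 _) unzip2_zip ?size_iota.
  apply/all_filterP; rewrite -(all_map fst (fun i => i != size a)).
  by rewrite -/(unzip1 _) unzip1_zip ?size_iota //; apply/allP.
by congr (_ ++ _); apply: P => i; rewrite mem_iota; lia.
Qed.

Section Operations.
Variables (R : realType) (N d : nat).
Notation conf := (soconf R N d).
Notation skew := (skew_delta R).
Implicit Types (c : conf) (e f : edge d) (l b p : seq (edge d)) (s : seq (seq (edge d))).

Definition wprod c s : R := \prod_(l <- s) wilson c l.
Definition others c s k : R := \prod_(il <- idx s | il.1 != k) wilson c il.2.
Definition others2 c s k r : R :=
  \prod_(il <- idx s | (il.1 != k) && (il.1 != r)) wilson c il.2.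

Lemma idx_remove s kl : kl \in idx s ->
  [seq il.2 | il <- idx s & il.1 != kl.1] = take kl.1 s ++ drop kl.1.+1 s.
Proof.
move=> /mem_enumerate[lt sE].
have := enumerate_remove (take kl.1 s) (drop kl.1.+1 s) kl.2.
by rewrite -sE size_takel // ltnW.
Qed.

Lemma othersE c s kl : kl \in idx s ->
  others c s kl.1 = wprod c (take kl.1 s) * wprod c (drop kl.1.+1 s).
Proof.
move=> kls; rewrite /others -big_filter -(big_map snd xpredT (wilson c)).
by rewrite idx_remove // big_cat.
Qed.

Lemma wprod_replace_at c s kl (L : seq (seq (edge d))) : kl \in idx s ->
  wprod c (replace_at s kl.1 L) = wprod c L * others c s kl.1.
Proof.
move=> /othersE->; rewrite /wprod /replace_at !big_cat /=; ring.
Qed.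

Lemma wprod_others c s kl : kl \in idx s ->
  wprod c s = wilson c kl.2 * others c s kl.1.
Proof.
move=> kls; have [_ sE] := mem_enumerate kls.
transitivity (wprod c (replace_at s kl.1 [:: kl.2])); first by rewrite [in LHS]sE.
by rewrite wprod_replace_at // /wprod big_seq1.
Qed.

Lemma size_replace_at s kl (L : seq (seq (edge d))) : kl \in idx s ->
  (size (replace_at s kl.1 L) = size s + size L - 1)%N.
Proof.
move=> /mem_enumerate[lt _].
rewrite /replace_at !size_cat size_drop size_takel; last exact: ltnW.
by case: kl lt => k x /=; move: (size s) (size L) => n m; lia.
Qed.

Lemma wprod_merge_into c s kl r m : kl \in idx s -> kl.1 != r ->
  wprod c (merge_into s kl.1 r m) = wilson c m * others2 c s kl.1 r.
Proof.
move=> kls kr; rewrite /wprod /merge_into big_map.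
rewrite (bigD1_seq kl) ?mem_filter ?kr ?filter_uniq ?uniq_enumerate //=.
rewrite eqxx big_filter_cond; congr (_ * _).
rewrite big_seq_cond [RHS]big_seq_cond; apply: eq_big => [il|il].
  case: (boolP (il \in idx s)) => //= ils.
  by rewrite (enumerate_eq_fst ils kls) andbC.
by move=> /and3P[ils _]; rewrite (enumerate_eq_fst ils kls) => /negPf->.
Qed.

Lemma size_merge_into s k rl m : rl \in idx s ->
  size (merge_into s k rl.1 m) = (size s).-1.
Proof.
move=> rls; have [lt _] := mem_enumerate rls.
rewrite /merge_into size_map -(size_map snd) idx_remove //.
rewrite size_cat size_drop size_takel; last exact: ltnW.
by case: rl rls lt => r x _ /=; move: (size s) => n; lia.
Qed.

Lemma big_single_ops (V : zmodType) F s (h : seq (seq (edge d)) -> V) :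
  \sum_(s' <- single_ops F s) h s' =
  \sum_(kl <- idx s) \sum_(xe <- loc kl.2) \sum_(yf <- loc kl.2)
    \sum_(L <- F kl.2 xe.1 xe.2 yf.1 yf.2) h (replace_at s kl.1 L).
Proof.
rewrite /single_ops big_flatten big_map; apply: eq_bigr => kl _.
rewrite big_flatten big_map; apply: eq_bigr => xe _.
rewrite big_flatten big_map; apply: eq_bigr => yf _.
by rewrite big_map.
Qed.

Lemma big_deform_ops (V : zmodType) op s (h : seq (seq (edge d)) -> V) :
  \sum_(s' <- deform_ops op s) h s' =
  \sum_(kl <- idx s) \sum_(xe <- loc kl.2)
    \sum_(p <- Pplus_at xe.2) \sum_(yf <- loc p)
      if related xe.2 yf.2 then
        h (replace_at s kl.1 [:: op kl.2 p xe.1 xe.2 yf.1 yf.2]) else 0.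
Proof.
rewrite /deform_ops big_flatten big_map; apply: eq_bigr => kl _.
rewrite big_flatten big_map; apply: eq_bigr => xe _.
rewrite big_flatten big_map; apply: eq_bigr => p _.
rewrite big_flatten big_map; apply: eq_bigr => yf _.
by case: ifP; rewrite ?big_seq1 ?big_nil.
Qed.

Lemma big_merger_ops (V : zmodType) op s (h : seq (seq (edge d)) -> V) :
  \sum_(s' <- merger_ops op s) h s' =
  \sum_(kl <- idx s) \sum_(xe <- loc kl.2)
    \sum_(rl <- idx s | rl.1 != kl.1) \sum_(yf <- loc rl.2)
      if related xe.2 yf.2 then
        h (merge_into s kl.1 rl.1 (op kl.2 rl.2 xe.1 xe.2 yf.1 yf.2)) else 0.
Proof.
rewrite /merger_ops big_flatten big_map; apply: eq_bigr => kl _.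
under [RHS]eq_bigr do rewrite big_mkcond /=.
rewrite exchange_big big_flatten big_map /=; apply: eq_bigr => rl _.
rewrite big_flatten big_map; apply: eq_bigr => xe _.
rewrite big_flatten big_map eq_sym; case: ifP => /= _; last first.
  by rewrite big1 // => yf _; rewrite big_nil.
by apply: eq_bigr => yf _; case: ifP; rewrite ?big_seq1 ?big_nil.
Qed.

(** Contribution of a second letter [f] of the loop [e b f q], always a negative operation minus a
    positive one: twisting minus splitting for equal edges, splitting minus twisting for opposite
    ones. *)
Definition split_op c e b f q : R :=
  if f == e then
    wilson c (core (Defs.pinv b ++ q)) -
    wilson c (core (e :: q)) * wilson c (core (b ++ [:: e]))
  else if f == einv e then
    wilson c (core q) * wilson c (core b) -
    wilson c (core (e :: Defs.pinv b ++ einv e :: q))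
  else 0.

Definition merge_op c l l' x e y f : R :=
  if related e f then
    wilson c (merge_neg l l' x e y f) - wilson c (merge_pos l l' x e y f)
  else 0.

Lemma contract_split e0 c e b f q : e = e0 \/ e = einv e0 ->
  \sum_i \sum_j \tr (dQe e0 (skew i j) c e *m word c b *m
     (dQe e0 (skew i j) c f *m word c q)) = 2 * split_op c e b f q.
Proof.
move=> ee0; rewrite /split_op; case: eqVneq => [->|fe].
  rewrite contract_split_same // !wilson_core !wilsonE !word_cat word_pinv.
  by rewrite !word_cons word_nil mulmx1.
case: eqVneq => [->|fe'].
  rewrite contract_split_inv // !wilson_core !wilsonE word_cons !word_cat word_pinv.
  by rewrite word_cons Qe_einv.
rewrite mulr0 big1 // => i _; rewrite big1 // => j _.
rewrite (@dQe_unrelated _ _ _ _ _ _ _ f ee0) ?mul0mx ?mulmx0 ?mxtrace0 //.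
by rewrite /related (negPf fe) (negPf fe').
Qed.

(** With [l'] another loop of the sequence this produces the mergers, and with [l'] a plaquette of
    the weight the deformations. *)
Lemma contract_merge e0 c l l' x e y f : e = e0 \/ e = einv e0 ->
  \sum_i \sum_j cut_loop e0 (skew i j) c l x e * cut_loop e0 (skew i j) c l' y f =
  2 * merge_op c l l' x e y f.
Proof.
move=> ee0; rewrite /merge_op /related /cut_loop /merge_neg /merge_pos.
case: eqVneq => [->|fe] /=.
  rewrite contract_merge_same // !wilson_core !wilsonE.
  rewrite !word_cat !word_cons !word_cat !word_cons !word_pinv.
  rewrite !trmx_mul.
  by rewrite !(mxtrace_mulC (word c (take x l))) -!mulmxA.
case: eqVneq => [->|fe'].
  rewrite contract_merge_inv // !wilson_core !wilsonE.
  rewrite !word_cat !word_cons !word_cat !word_cons !word_pinv.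
  rewrite !trmx_mul.
  by rewrite !(mxtrace_mulC (word c (take x l))) -!mulmxA.
rewrite mulr0 big1 // => i _; rewrite big1 // => j _.
rewrite (@dQe_unrelated _ _ _ _ _ _ _ f ee0) ?mul0mx ?mxtrace0 ?mulr0 //.
by rewrite /related (negPf fe) (negPf fe').
Qed.

End Operations.

(** * The equation at one location *)

Section LocationEquation.
Variables (R : realType) (N d : nat) (Lambda : seq (vertex d)) (beta : R).
Notation conf := (soconf R N d).
Notation skew := (skew_delta R).
Implicit Types (c : conf) (e f : edge d) (l b p : seq (edge d)) (s : seq (seq (edge d))).

Definition weight c : R := gauge_weight Lambda beta (matconf c).

(** Integrand of the equation at location [x] of the loop [l], with all terms on one side and the
    factor 2 removed. *)
Definition location_eq s k l x e c : R :=
  - ((N%:R - 1) * wprod c s)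
  + (\sum_(yf <- loc l | x != yf.1)
       split_op c e (part_b l x yf.1) yf.2 (part_c l x yf.1)) * others c s k
  + \sum_(rl <- idx s | rl.1 != k) \sum_(yf <- loc rl.2)
       merge_op c l rl.2 x e yf.1 yf.2 * others2 c s k rl.1
  + N%:R * beta * \sum_(p <- Pplus_at e) \sum_(yf <- loc p)
       merge_op c l p x e yf.1 yf.2 * others c s k.

Lemma sum2D (F G : 'I_N -> 'I_N -> R) :
  \sum_i \sum_j (F i j + G i j) = \sum_i \sum_j F i j + \sum_i \sum_j G i j.
Proof. by rewrite -big_split; apply: eq_bigr => i _; rewrite big_split. Qed.

Lemma sum2Ml (F : 'I_N -> 'I_N -> R) a :
  \sum_i \sum_j (F i j * a) = (\sum_i \sum_j F i j) * a.
Proof. by rewrite mulr_suml; apply: eq_bigr => i _; rewrite mulr_suml. Qed.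

Lemma sum2_sum (I : Type) (r : seq I) (P : pred I) (F : 'I_N -> 'I_N -> I -> R) :
  \sum_i \sum_j \sum_(k <- r | P k) F i j k = \sum_(k <- r | P k) \sum_i \sum_j F i j k.
Proof.
rewrite [RHS]exchange_big; apply: eq_bigr => i _; exact: exchange_big.
Qed.

Section Location.
Variables (s : seq (seq (edge d))) (kl : nat * seq (edge d)) (xe : nat * edge d).
Hypotheses (kls : kl \in idx s) (xel : xe \in loc kl.2).
Let k := kl.1.
Let l := kl.2.
Let x := xe.1.
Let e := xe.2.
Let e0 := if positive e then e else einv e.
Let m := drop x.+1 l ++ take x l.

Hypothesis nbhdL : {subset nbhd (eu e) ++ nbhd (ev e) <= undup Lambda}.

Lemma positive_rep : positive e0.
Proof.
by rewrite /e0; case: (boolP (positive e)) => // ne; rewrite positive_einv.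
Qed.

Lemma edge_rep : e = e0 \/ e = einv e0.
Proof. by rewrite /e0; case: (positive e); rewrite ?einvK; [left|right]. Qed.

Lemma loc_split : l = take x l ++ e :: drop x.+1 l.
Proof. by have [] := mem_enumerate xel. Qed.

Lemma size_take_loc : size (take x l) = x.
Proof. by have [lt _] := mem_enumerate xel; rewrite size_takel // ltnW. Qed.

Definition cutX (X : 'M[R]_N) c l' y f := cut_loop e0 X c l' y f.

(** The product rule for one direction [X]: the derivative falls on the cut letter, on the rest of
    its loop, on another loop, or on the exponent of the weight. *)
Definition location_der (X : 'M[R]_N) c : R :=
  ((\tr (ddQe e0 X c e *m word c m) +
     \sum_(p <- loc m) \tr (dQe e0 X c e *m word c (take p.1 m) *m
        (dQe e0 X c p.2 *m word c (drop p.1.+1 m)))) * others c s k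
   + cutX X c l x e * \sum_(rl <- idx s | rl.1 != k)
       (\sum_(yf <- loc rl.2) cutX X c rl.2 yf.1 yf.2) * others2 c s k rl.1) * weight c
  + cutX X c l x e * others c s k * (weight c * (N%:R * beta *
      \sum_(p <- Pplus_in (undup Lambda)) \sum_(yf <- loc p) cutX X c p yf.1 yf.2)).

Lemma isder_location (X : 'M[R]_N) (g : R -> SO R N) (Kg : R) :
  X^T = - X ->
  (forall t i j, 0 <= t <= 1 ->
    `|soval (g t) i j - (1%:M i j + t * X i j)| <= Kg * t ^+ 2) ->
  isder e0 g (fun c => cutX X c l x e * others c s k * weight c) (location_der X).
Proof.
move=> XT gX; have ep := positive_rep.
have dW l' := isder_wilson ep XT gX l'.
apply: isder_mul; last first.
  apply: isder_expR.
  have := isder_mul (isder_cst e0 g (N%:R * beta)) (isder_sum (Pplus_in (undup Lambda)) dW).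
  by apply: eq_isder => c //; rewrite mul0r add0r.
apply: isder_mul; first exact: (isder_cut_loop ep XT gX).
have ui : uniq [seq il <- idx s | il.1 != k] by rewrite filter_uniq ?uniq_enumerate.
have := isder_prod ui (fun il => dW il.2).
apply: eq_isder => c; first by rewrite /others big_filter.
rewrite big_filter big_seq_cond [RHS]big_seq_cond; apply: eq_bigr => rl /andP[rls _].
congr (_ * _); rewrite big_filter_cond /others2 big_seq_cond [RHS]big_seq_cond.
apply: eq_bigl => jl; case: (boolP (jl \in idx s)) => //= jls.
by rewrite (enumerate_eq_fst jls rls).
Qed.

Lemma sum_location_der c :
  \sum_i \sum_j location_der (skew i j) c = 2 * (location_eq s k l x e c * weight c).
Proof.
have ee := edge_rep.
pose O := others c s k; pose w := weight c.
transitivity (\sum_i \sum_j (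
    \tr (ddQe e0 (skew i j) c e *m word c m) * (O * w) +
    (\sum_(p <- loc m) \tr (dQe e0 (skew i j) c e *m word c (take p.1 m) *m
        (dQe e0 (skew i j) c p.2 *m word c (drop p.1.+1 m)))) * (O * w) +
    (\sum_(rl <- idx s | rl.1 != k) \sum_(yf <- loc rl.2)
       cutX (skew i j) c l x e * cutX (skew i j) c rl.2 yf.1 yf.2 * others2 c s k rl.1) * w +
    (\sum_(p <- Pplus_in (undup Lambda)) \sum_(yf <- loc p)
       cutX (skew i j) c l x e * cutX (skew i j) c p yf.1 yf.2 * O) * (N%:R * beta * w))).
  apply: sum2_eq => i j; rewrite /location_der -/O -/w.
  move: (cutX _ _ l x e) => A.
  have -> : \sum_(rl <- idx s | rl.1 != k) \sum_(yf <- loc rl.2)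
       A * cutX (skew i j) c rl.2 yf.1 yf.2 * others2 c s k rl.1 =
     A * \sum_(rl <- idx s | rl.1 != k)
       (\sum_(yf <- loc rl.2) cutX (skew i j) c rl.2 yf.1 yf.2) * others2 c s k rl.1.
    rewrite mulr_sumr; apply: eq_bigr => rl _.
    by rewrite mulr_suml mulr_sumr; apply: eq_bigr => yf _; rewrite mulrA.
  have -> : \sum_(p <- Pplus_in (undup Lambda)) \sum_(yf <- loc p)
       A * cutX (skew i j) c p yf.1 yf.2 * O =
     A * (\sum_(p <- Pplus_in (undup Lambda)) \sum_(yf <- loc p) cutX (skew i j) c p yf.1 yf.2) * O.
    rewrite mulr_sumr mulr_suml; apply: eq_bigr => p _.
    by rewrite mulr_sumr mulr_suml.
  ring.
rewrite !sum2D !sum2Ml contract_diag // !sum2_sum.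
have -> : \sum_(p <- loc m) \sum_i \sum_j
    \tr (dQe e0 (skew i j) c e *m word c (take p.1 m) *m
        (dQe e0 (skew i j) c p.2 *m word c (drop p.1.+1 m))) =
    2 * \sum_(yf <- loc l | x != yf.1)
       split_op c e (part_b l x yf.1) yf.2 (part_c l x yf.1).
  rewrite mulr_sumr.
  transitivity (\sum_(p <- loc m) 2 * split_op c e (take p.1 m) p.2 (drop p.1.+1 m)).
    by apply: eq_bigr => p _; exact: contract_split.
  rewrite (big_loc_rot (take x l) (drop x.+1 l) e (fun b f q => 2 * split_op c e b f q)).
  by rewrite -loc_split size_take_loc.
have -> : \sum_(rl <- idx s | rl.1 != k) \sum_i \sum_j \sum_(yf <- loc rl.2)
      cutX (skew i j) c l x e * cutX (skew i j) c rl.2 yf.1 yf.2 * others2 c s k rl.1 =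
   2 * \sum_(rl <- idx s | rl.1 != k) \sum_(yf <- loc rl.2)
       merge_op c l rl.2 x e yf.1 yf.2 * others2 c s k rl.1.
  rewrite mulr_sumr; apply: eq_bigr => rl _; rewrite sum2_sum mulr_sumr.
  by apply: eq_bigr => yf _; rewrite sum2Ml contract_merge // mulrA.
have -> : \sum_(p <- Pplus_in (undup Lambda)) \sum_i \sum_j \sum_(yf <- loc p)
      cutX (skew i j) c l x e * cutX (skew i j) c p yf.1 yf.2 * O =
   2 * \sum_(p <- Pplus_at e) \sum_(yf <- loc p)
       merge_op c l p x e yf.1 yf.2 * others c s k.
  (* Plaquettes of [Lambda] avoiding both [e] and its inverse have no related letter, so [merge_op]
     vanishes on them. *)
  rewrite mulr_sumr -(@big_Pplus_at _ _ (undup Lambda)) ?undup_uniq //; last first.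
    move=> p pe; rewrite big_seq big1 ?mulr0 // => yf /(map_f snd).
    rewrite -/(unzip2 _) unzip2_zip ?size_iota // => fp.
    rewrite /merge_op /related; case: ifP; last by rewrite mul0r.
    move=> /orP[]/eqP fe; move: pe; rewrite -fe fp ?orbT //.
  apply: eq_bigr => p _; rewrite sum2_sum mulr_sumr.
  by apply: eq_bigr => yf _; rewrite sum2Ml contract_merge // mulrA.
have wl : \tr (Qe c e *m word c m) = wilson c l.
  by rewrite wilsonE [in RHS]loc_split /m !word_cat word_cons [RHS]mxtrace_mulC !mulmxA.
by rewrite wl /location_eq (wprod_others _ kls) -/O -/w -/l -/k; ring.
Qed.

Variable sigma : probability (SOm R N) R.
Hypothesis haar : is_haar sigma.

Lemma soint_location (es : seq (edge d)) c0 : e0 \in es ->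
  bm (fun c => location_eq s k l x e c * weight c) /\
  soint sigma es (fun c => location_eq s k l x e c * weight c) c0 = 0.
Proof.
move=> e0es.
have D i j : bm (location_der (skew i j)) /\
    soint sigma es (location_der (skew i j)) c0 = 0.
  have [g [K gX]] := skew_delta_tangent R i j.
  have dF := isder_location (trmx_skew_delta R i j) gX.
  by split; [case: dF|exact: soint_isder dF e0es].
(* The factor [2^-1] undoes the 2 of the contraction; the sums run over [enum 'I_N] to fit the
   lemmas on sums over lists. *)
have -> : (fun c => location_eq s k l x e c * weight c) =
    (fun c => 2^-1 * \sum_(i <- enum 'I_N) \sum_(j <- enum 'I_N) location_der (skew i j) c).
  apply/funext => c; rewrite big_enum /=; under eq_bigr do rewrite big_enum /=.
  by rewrite sum_location_der mulKf ?pnatr_eq0.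
have bS i : bm (fun c => \sum_(j <- enum 'I_N) location_der (skew i j) c).
  by apply: bm_sum => j; case: (D i j).
have bSS : bm (fun c => \sum_(i <- enum 'I_N) \sum_(j <- enum 'I_N) location_der (skew i j) c).
  by apply: bm_sum.
split; first by apply: bm_mul => //; exact: bm_cst.
rewrite sointZ // soint_sum // big1 ?mulr0 // => i _.
rewrite soint_sum => [|j]; last by case: (D i j).
by rewrite big1 // => j _; case: (D i j).
Qed.

End Location.
End LocationEquation.

(** * Summation over all locations and integration *)

Section Summation.
Variables (R : realType) (N d : nat) (Lambda : seq (vertex d)) (beta : R).
Notation conf := (soconf R N d).
Notation weight := (@weight R N d Lambda beta).
Implicit Types (c : conf) (e f : edge d) (l b p : seq (edge d)) (s : seq (seq (edge d))).

Lemma bm_word l i j : bm (fun c : conf => word c l i j).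
Proof.
elim: l i j => [|f l IH] i j; first exact: bm_cst.
under eq_fun do rewrite word_cons mxE.
rewrite (_ : (fun c => _) =
    (fun c : conf => \sum_(k <- enum 'I_N) Qe c f i k * word c l k j)).
  apply: bm_sum => k; apply: bm_mul => //; rewrite /Qe /Qof.
  case: (positive f); first exact: bm_entry.
  by under eq_fun do rewrite mxE; exact: bm_entry.
by apply/funext => c; rewrite big_enum.
Qed.

Lemma bm_wilson l : bm (fun c : conf => wilson c l).
Proof.
rewrite (_ : (fun c => _) = (fun c : conf => \sum_(i <- enum 'I_N) word c l i i)).
  by apply: bm_sum => i; exact: bm_word.
by apply/funext => c; rewrite big_enum.
Qed.

Lemma bm_wprod_weight s : bm (fun c : conf => wprod c s * weight c).
Proof.
apply: bm_mul; first by apply: bm_prod => l; exact: bm_wilson.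
apply: bm_expR; apply: bm_mul; first exact: bm_cst.
by apply: bm_sum => p; exact: bm_wilson.
Qed.

(* All terms on one side; the factors [N] and [1/N] of the splittings and mergers
   only appear with the normalisation [N ^- size s'] of [phi]. *)
Definition master_terms s : seq (R * seq (seq (edge d))) :=
  (- ((N%:R - 1) * (seq_len s)%:R), s) ::
  [seq (1, s') | s' <- Tminus s] ++ [seq (- 1, s') | s' <- Tplus s] ++
  [seq (1, s') | s' <- Sminus s] ++ [seq (- 1, s') | s' <- Splus s] ++
  [seq (1, s') | s' <- Mminus s] ++ [seq (- 1, s') | s' <- Mplus s] ++
  [seq (N%:R * beta, s') | s' <- Dminus s] ++ [seq (- (N%:R * beta), s') | s' <- Dplus s].

Lemma big_master_terms s (h : seq (seq (edge d)) -> R) :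
  \sum_(t <- master_terms s) t.1 * h t.2 =
  - ((N%:R - 1) * (seq_len s)%:R * h s)
  + (\sum_(s' <- Tminus s) h s' - \sum_(s' <- Tplus s) h s')
  + (\sum_(s' <- Sminus s) h s' - \sum_(s' <- Splus s) h s')
  + (\sum_(s' <- Mminus s) h s' - \sum_(s' <- Mplus s) h s')
  + N%:R * beta * (\sum_(s' <- Dminus s) h s' - \sum_(s' <- Dplus s) h s').
Proof.
rewrite /master_terms big_cons !big_cat !big_map /= -!mulr_sumr.
ring.
Qed.

Lemma split_op_ops c s kl xe yf : kl \in idx s ->
  (if xe.1 != yf.1 then
     split_op c xe.2 (part_b kl.2 xe.1 yf.1) yf.2 (part_c kl.2 xe.1 yf.1) *
       others c s kl.1 else 0) =
  \sum_(L <- if (xe.1 != yf.1) && (yf.2 == xe.2)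
             then [:: [:: twist_same kl.2 xe.1 yf.1]] else [::])
      wprod c (replace_at s kl.1 L) -
  \sum_(L <- if (xe.1 != yf.1) && (yf.2 == einv xe.2)
             then [:: [:: twist_inv kl.2 xe.1 yf.1 xe.2]] else [::])
      wprod c (replace_at s kl.1 L) +
  (\sum_(L <- if (xe.1 != yf.1) && (yf.2 == einv xe.2)
             then [:: [:: split1_inv kl.2 xe.1 yf.1; split2_inv kl.2 xe.1 yf.1]] else [::])
      wprod c (replace_at s kl.1 L) -
  \sum_(L <- if (xe.1 != yf.1) && (yf.2 == xe.2)
             then [:: [:: split1_same kl.2 xe.1 yf.1 xe.2;
                         split2_same kl.2 xe.1 yf.1 xe.2]] else [::])
      wprod c (replace_at s kl.1 L)).
Proof.
move=> kls; case: (xe.1 != yf.1) => /=; last by rewrite !big_nil !subr0 addr0.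
have W1 a : wprod c [:: a] = wilson c a by rewrite /wprod big_seq1.
have W2 a b : wprod c [:: a; b] = wilson c a * wilson c b.
  by rewrite /wprod big_cons big_seq1.
rewrite /split_op; case: eqVneq => [->|fe].
  rewrite eq_sym (negPf (einv_neq _)) !big_seq1 !big_nil !wprod_replace_at // W1 W2.
  by rewrite /twist_same /split1_same /split2_same; ring.
case: eqVneq => [_|_].
  rewrite !big_seq1 !big_nil !wprod_replace_at // W1 W2.
  by rewrite /twist_inv /split1_inv /split2_inv; ring.
by rewrite !big_nil mul0r !subr0 addr0.
Qed.

(** A pointwise identity: the pairs (component, location) number [|s|], and together with the second
    location they enumerate each collection of operations with its multiplicity. *)
Lemma sum_location_eq c s :
  \sum_(kl <- idx s) \sum_(xe <- loc kl.2)
    location_eq beta s kl.1 kl.2 xe.1 xe.2 c =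
  \sum_(t <- master_terms s) t.1 * wprod c t.2.
Proof.
rewrite big_master_terms /Tminus /Tplus /Sminus /Splus /Mminus /Mplus /Dminus /Dplus.
rewrite !big_single_ops !big_merger_ops !big_deform_ops.
have -> : (N%:R - 1) * (seq_len s)%:R * wprod c s =
    \sum_(kl <- idx s) \sum_(xe <- loc kl.2) (N%:R - 1) * wprod c s.
  have -> : seq_len s = (\sum_(kl <- idx s) size (loc kl.2))%N.
    transitivity (\sum_(kl <- idx s) size kl.2)%N.
      rewrite /seq_len sumnE big_map -(big_map snd xpredT size).
      by rewrite -/(unzip2 _) unzip2_zip ?size_iota.
    by apply: eq_bigr => kl _; rewrite size_zip size_iota minnn.
  rewrite natr_sum mulr_sumr mulr_suml; apply: eq_bigr => kl _.
  rewrite (big_const_seq) count_predT iter_addr_0 -mulr_natr; ring.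
rewrite -!sumrB mulr_sumr -sumrN -!big_split /= big_seq [RHS]big_seq.
apply: eq_bigr => kl kls.
rewrite -!sumrB mulr_sumr -sumrN -!big_split /=.
apply: eq_bigr => xe _; rewrite /location_eq; congr (_ + _ + _).
- rewrite -addrA; congr (_ + _).
  rewrite mulr_suml big_mkcond /= -!sumrB -big_split /=.
  by apply: eq_bigr => yf _; exact: split_op_ops.
- rewrite -sumrB big_seq_cond [RHS]big_seq_cond; apply: eq_bigr => rl /andP[rls rk].
  rewrite -sumrB; apply: eq_bigr => yf _; rewrite /merge_op.
  case: ifP => _; last by rewrite mul0r subrr.
  by rewrite !wprod_merge_into 1?eq_sym // mulrBl.
- congr (_ * _); rewrite -sumrB; apply: eq_bigr => p _.
  rewrite -sumrB; apply: eq_bigr => yf _; rewrite /merge_op.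
  case: ifP => _; last by rewrite mul0r subrr.
  by rewrite !wprod_replace_at // /wprod !big_seq1 mulrBl.
Qed.

Variable sigma : probability (SOm R N) R.
Hypothesis haar : is_haar sigma.
Variable s : seq (seq (edge d)).
Hypothesis loops : forall l, l \in s -> is_loop l.
Hypothesis inside : forall l, l \in s -> forall e, e \in l -> forall w : vertex d,
  within1 (eu e) w -> w \in Lambda.

Let es := Eplus_in (undup Lambda).
Let c0 : conf := fun=> mkSO (@SOpred1 R N).

Lemma nbhd_inside l e : l \in s -> e \in l ->
  {subset nbhd (eu e) ++ nbhd (ev e) <= undup Lambda}.
Proof.
move=> ls el w; rewrite mem_cat mem_undup => /orP[/nbhd_within1|].
  exact: inside ls _ el _.
have /and3P[cl _ _] := loops ls.
have [f fl <-] := closed_next cl el.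
by move=> /nbhd_within1; exact: inside ls _ fl _.
Qed.

Lemma soint_master_terms :
  \sum_(t <- master_terms s)
    t.1 * soint sigma es (fun c => wprod c t.2 * weight c) c0 = 0.
Proof.
pose G (kl : nat * seq (edge d)) (xe : nat * edge d) c :=
  location_eq beta s kl.1 kl.2 xe.1 xe.2 c * weight c.
have loc0 kl xe : kl \in idx s -> xe \in loc kl.2 ->
    bm (G kl xe) /\ soint sigma es (G kl xe) c0 = 0.
  move=> kls xel.
  have ls : kl.2 \in s.
    by have := map_f snd kls; rewrite -/(unzip2 _) unzip2_zip ?size_iota.
  have el : xe.2 \in kl.2.
    by have := map_f snd xel; rewrite -/(unzip2 _) unzip2_zip ?size_iota.
  have nb := nbhd_inside ls el.
  apply: (soint_location beta kls xel nb haar).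
  (* Both ends of the edge lie in [Lambda], so its positive representative is one of the integrated
     variables. *)
  have ue : eu xe.2 \in undup Lambda by apply: nb; rewrite mem_cat mem_nbhd.
  have ve : ev xe.2 \in undup Lambda by apply: nb; rewrite mem_cat mem_nbhd orbT.
  rewrite /es mem_filter; case: ifP => [->|/negbT pe]; rewrite mem_edges_in.
    by rewrite ue ve.
  by rewrite positive_einv pe ev_einv ue ve.
have lin (I : eqType) (r : seq I) (H : I -> conf -> R) :
    (forall i, i \in r -> bm (H i) /\ soint sigma es (H i) c0 = 0) ->
    bm (fun c => \sum_(i <- r) H i c) /\ soint sigma es (fun c => \sum_(i <- r) H i c) c0 = 0.
  (* The hypothesis covers only members of [r], whereas [soint_sum] asks for every index; the terms
     are extended by zero. *)
  move=> hr; have hr' i : bm (fun c => if i \in r then H i c else 0).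
    by case: (boolP (i \in r)) => [ir|_]; [case: (hr i ir)|exact: bm_cst].
  rewrite (_ : (fun c => _) = (fun c => \sum_(i <- r) if i \in r then H i c else 0)).
    split; first exact: bm_sum.
    rewrite soint_sum // big_seq big1 // => i ir.
    by rewrite ir; case: (hr i ir).
  by apply/funext => c; apply: eq_big_seq => i ->.
have [_ I0] : bm (fun c => \sum_(kl <- idx s) \sum_(xe <- loc kl.2) G kl xe c) /\
    soint sigma es (fun c => \sum_(kl <- idx s) \sum_(xe <- loc kl.2) G kl xe c) c0 = 0.
  by apply: (@lin) => kl kls; apply: (@lin) => xe xel; exact: loc0.
rewrite -[RHS]I0 (_ : (fun c => \sum_(kl <- idx s) _) =
    (fun c => \sum_(t <- master_terms s) t.1 * (wprod c t.2 * weight c))); last first.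
  apply/funext => c; transitivity ((\sum_(t <- master_terms s) t.1 * wprod c t.2) * weight c).
    rewrite -sum_location_eq mulr_suml; apply: eq_bigr => kl _; by rewrite mulr_suml.
  by rewrite mulr_suml; apply: eq_bigr => t _; rewrite mulrA.
rewrite soint_sum => [|t]; last by apply: bm_mul; [exact: bm_cst|exact: bm_wprod_weight].
by apply: eq_bigr => t _; rewrite sointZ //; exact: bm_wprod_weight.
Qed.

Let Z := iint sigma es (gauge_weight Lambda beta) (@config0 R N d).
Let J s' : R := soint sigma es (fun c => wprod c s' * weight c) c0 / Z.

Lemma phiE s' : phi sigma Lambda beta s' = J s' / N%:R ^+ size s'.
Proof.
rewrite /phi /expect; congr (_ / _ / _).
have -> : @config0 R N d = matconf c0 by [].
exact: iint_matconf.
Qed.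

(** All members of a collection have equally many components, null loops included, so a single power
    of [N] factors out. *)
Lemma sum_phi (r : seq (seq (seq (edge d)))) n : {in r, forall s', size s' = n} ->
  \sum_(s' <- r) phi sigma Lambda beta s' = (\sum_(s' <- r) J s') / N%:R ^+ n.
Proof.
by move=> sz; rewrite mulr_suml; apply: eq_big_seq => s' /sz <-; rewrite phiE.
Qed.

Lemma master_equation :
  (N%:R - 1) * (seq_len s)%:R * J s =
  (\sum_(s' <- Tminus s) J s' - \sum_(s' <- Tplus s) J s')
  + (\sum_(s' <- Sminus s) J s' - \sum_(s' <- Splus s) J s')
  + (\sum_(s' <- Mminus s) J s' - \sum_(s' <- Mplus s) J s')
  + N%:R * beta * (\sum_(s' <- Dminus s) J s' - \sum_(s' <- Dplus s) J s').
Proof.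
have : \sum_(t <- master_terms s) t.1 * J t.2 = 0.
  transitivity ((\sum_(t <- master_terms s)
      t.1 * soint sigma es (fun c => wprod c t.2 * weight c) c0) / Z); last first.
    by rewrite soint_master_terms mul0r.
  rewrite mulr_suml.
  by apply: eq_bigr => t _; rewrite mulrA.
rewrite big_master_terms -!addrA => /eqP; rewrite addrC addr_eq0 opprK => /eqP <-.
by rewrite !addrA.
Qed.

End Summation.

(** * Number of components after each operation *)

Section Sizes.
Variable d : nat.
Implicit Types (s : seq (seq (edge d))).

Lemma size_single_ops F s m :
  (forall l x e y f L, L \in F l x e y f -> size L = m.+1) ->
  {in single_ops F s, forall s', size s' = (size s + m)%N}.
Proof.
move=> FL s' /flatten_mapP[kl kls /flatten_mapP[xe _ /flatten_mapP[yf _ /mapP[L /FL sL ->]]]].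
by rewrite size_replace_at // sL addnS subn1.
Qed.

Lemma size_merger_ops op s :
  {in merger_ops op s, forall s', size s' = (size s).-1}.
Proof.
move=> s' /flatten_mapP[kl _ /flatten_mapP[rl rls /flatten_mapP[xe _ /flatten_mapP[yf _]]]].
by case: ifP => // _; rewrite inE => /eqP->; exact: size_merge_into.
Qed.

Lemma size_deform_ops op s :
  {in deform_ops op s, forall s', size s' = size s}.
Proof.
move=> s' /flatten_mapP[kl kls /flatten_mapP[xe _ /flatten_mapP[p _ /flatten_mapP[yf _]]]].
by case: ifP => // _; rewrite inE => /eqP->; rewrite size_replace_at // addnK.
Qed.

End Sizes.

Theorem theorem3p6 (d : nat) (Lambda : seq (vertex d)) (N : nat) (R : realType)
  (beta : R) (sigma : probability (SOm R N) R) (s : seq (seq (edge d))) :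
  (2 <= d)%N -> (2 <= N)%N -> Lambda != [::] -> is_haar sigma ->
  (* s is a non-null loop sequence given by its minimal representation *)
  s != [::] -> (forall l, l \in s -> is_loop l && (l != [::])) ->
  (* every vertex at distance <= 1 from a vertex of some l_i lies in Lambda *)
  (forall l, l \in s -> forall e, e \in l -> forall w : vertex d,
     within1 (eu e) w -> w \in Lambda) ->
  let phi := phi sigma Lambda beta in
  (N%:R - 1) * (seq_len s)%:R * phi s =
      \sum_(s' <- Tminus s) phi s' - \sum_(s' <- Tplus s) phi s'
    + N%:R * \sum_(s' <- Sminus s) phi s' - N%:R * \sum_(s' <- Splus s) phi s'
    + N%:R^-1 * \sum_(s' <- Mminus s) phi s' - N%:R^-1 * \sum_(s' <- Mplus s) phi s'
    + N%:R * beta * \sum_(s' <- Dminus s) phi s'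
    - N%:R * beta * \sum_(s' <- Dplus s) phi s'.
Proof.
move=> _ N2 _ haar s0 loops inside /=.
have N0 : N%:R != 0 :> R by rewrite pnatr_eq0; case: (N) N2.
have loops' l : l \in s -> is_loop l by move=> /loops/andP[].
have E := master_equation beta haar loops' inside.
(* Mergers have [n] components, twistings and deformations [n + 1], splittings [n + 2]: relative to
   [N^(n+1)] this yields the factors [1/N], 1 and [N]. *)
have [n sn] : exists n, size s = n.+1 by case: (s) s0 => // l q _; exists (size q).
have T1 F : (forall l x e y f L, L \in F l x e y f -> size L = 1%N) ->
    {in single_ops F s, forall s', size s' = n.+1}.
  by move=> h s' /(size_single_ops h)->; rewrite addn0 sn.
have S2 F : (forall l x e y f L, L \in F l x e y f -> size L = 2%N) ->
    {in single_ops F s, forall s', size s' = n.+2}.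
  by move=> h s' /(size_single_ops h)->; rewrite sn addn1.
have M0 op : {in merger_ops op s, forall s', size s' = n}.
  by move=> s' /size_merger_ops->; rewrite sn.
have D1 op : {in deform_ops op s, forall s', size s' = n.+1}.
  by move=> s' /size_deform_ops->.
have one (b : bool) (L0 L : seq (seq (edge d))) :
  L \in (if b then [:: L0] else [::]) -> L = L0 by case: b => //; rewrite inE => /eqP.
have Tm : {in Tminus s, forall s', size s' = n.+1} by apply: T1 => l x e y f L /one->.
have Tp : {in Tplus s, forall s', size s' = n.+1} by apply: T1 => l x e y f L /one->.
have Sm : {in Sminus s, forall s', size s' = n.+2} by apply: S2 => l x e y f L /one->.
have Sp : {in Splus s, forall s', size s' = n.+2} by apply: S2 => l x e y f L /one->.
rewrite phiE sn (sum_phi _ _ _ Tm) (sum_phi _ _ _ Tp) (sum_phi _ _ _ Sm) (sum_phi _ _ _ Sp).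
rewrite !(sum_phi _ _ _ (M0 _)) !(sum_phi _ _ _ (D1 _)).
rewrite [LHS]mulrA E !exprS.
have q0 : N%:R ^+ n != 0 :> R by rewrite expf_neq0.
(* The sums are replaced by variables, with [M] for [N] and [q] for [N^n], leaving an identity of
   rational functions. *)
have alg (a1 a2 a3 a4 a5 a6 a7 a8 b M q : R) : M != 0 -> q != 0 ->
    (a1 - a2 + (a3 - a4) + (a5 - a6) + M * b * (a7 - a8)) / (M * q) =
    a1 / (M * q) - a2 / (M * q) + M * (a3 / (M * (M * q))) - M * (a4 / (M * (M * q)))
    + M^-1 * (a5 / q) - M^-1 * (a6 / q)
    + M * b * (a7 / (M * q)) - M * b * (a8 / (M * q)).
  by move=> nzM nzq; field; rewrite nzM nzq.
exact: alg.
Qed.
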